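(* Let $M$ be a finite orthogroup, $k$ a splitting field for $M$ whose characteristic divides the order of no maximal subgroup of $M$. Let $X,Y\in\Lambda(M)$, $U\in\mathrm{Irr}(G_X)$, $V\in\mathrm{Irr}(G_Y)$, with $e_X,e_Y$ the identities of $G_X,G_Y$. Then: (1) If $X,Y$ are incomparable or $X=Y$, there are no arrows from $U$ to $V$ in $Q(kM)$. (2) If $X<Y$, assume (as may be arranged) $e_X<e_Y$. Let $\equiv$ be the smallest equivalence relation on $e_YL_{e_X}$ such that (a) $e_Ymx\equiv e_Yme_Yx$ for $x\in L_{e_X}$ and $\sigma(m)\ge X$; (b) $x\equiv x'$ whenever $x,x'\in e_YL_{e_X}$, $e_Xx=e_Xx'$, and there is $e\in E(e_YMe_Y)$ with $X<\sigma(e)$, $e\ne e_Y$, $ex=x$, $ex'=x'$. Writing $[x]$ for the $\equiv$-class, let $V_{X,Y}$ be the subspace of $k[e_YL_{e_X}/{\equiv}]$ with basis the differences $[x]-[e_Xx]$, $x\in e_YL_{e_X}\setminus G_X$; it is a $G_Y\times G_X$-module via $(g,h)([x]-[e_Xx])=[gxh^{-1}]-[ge_Xxh^{-1}]$. The number of arrows from $U$ to $V$ is the multiplicity of $V\otimes_kU^*$ as an irreducible constituent of $V_{X,Y}$. (3) If $Y<X$, the number of arrows from $U$ to $V$ in $Q(kM)$ coincides with the number of arrows from $V$ to $U$ in $Q(kM^{op})$ (which can be computed by case (2) applied to $M^{op}$).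
   Context: $M$ finite monoid, $E(M)$ its idempotents, $m^\omega$ the idempotent power of $m$. $M$ is rectangular if each set $\{f\in E(M):MfM=MeM\}$ is closed under multiplication; an orthogroup is a rectangular monoid which is (von Neumann) regular, i.e. $m\in mMm$ for all $m$. $\Lambda(M)$: ideals $MeM$, $e\in E(M)$, ordered by inclusion; $\sigma(m)=Mm^\omega M$. For $X\in\Lambda(M)$, $e_X$ is a fixed idempotent with $Me_XM=X$ and $G_X$ the group of units of $e_XMe_X$; a $kG_X$-module is a $kM$-module via $m\mapsto e_Xme_X$ if $\sigma(m)\supseteq X$, $m\mapsto 0$ otherwise; these give the vertices of $Q(kM)$ (quiver: $\dim\mathrm{Ext}^1(S,T)$ arrows from $S$ to $T$). $L_m=\{n\in M: Mn=Mm\}$. $e<f$ for idempotents means $ef=e=fe$, $e\neq f$. $U^*$ is the contragredient. $M^{op}$ is the opposite monoid; its maximal subgroups are the $G_X^{op}$, and a $G_X$-module is regarded as a $G_X^{op}$-module via $g\mapsto g^{-1}$. $k$ splits $M$ if $kM/\mathrm{rad}(kM)$ is a product of matrix algebras over $k$. *)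

(* Defs.v *)
From HB Require Import structures.
From mathcomp Require Import all_boot all_order all_algebra.
From mathcomp Require Import mxtens.
Set Implicit Arguments. Unset Strict Implicit. Unset Printing Implicit Defensive.
Import GRing.Theory.
Local Open Scope ring_scope.

Record fmonoid := FMonoid {
  mcar :> finType;
  mmul : mcar -> mcar -> mcar;
  mone : mcar;
  mmulA : associative mmul;
  mmul1m : left_id mone mmul;
  mmulm1 : right_id mone mmul }.

Definition opmon (M : fmonoid) : fmonoid :=
  @FMonoid (mcar M) (fun x y => mmul y x) (mone M)
    (fun x y z => esym (@mmulA M z y x)) (@mmulm1 M) (@mmul1m M).

Declare Scope monoid_scope.
Section Monoid.
Variable M : fmonoid.
Local Notation "x * y" := (mmul x y) : monoid_scope.
Local Open Scope monoid_scope.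

Definition idem (e : M) : bool := e * e == e.
Definition idems : {set M} := [set e | idem e].
Definition tideal (x : M) : {set M} := [set a * x * b | a : M, b : M].
Definition lideal (x : M) : {set M} := [set a * x | a : M].
Fixpoint mpow (m : M) (n : nat) : M :=
  if n is n'.+1 then (if n' is 0 then m else m * mpow m n') else mone M.
Definition omega (m : M) : M :=
  odflt (mone M) [pick e | idem e &&
     [exists n : 'I_(#|M|.+1), (0 < (n : nat))%N && (e == mpow m n)]].
Definition sigma (m : M) : {set M} := tideal (omega m).
Definition Lambda : {set {set M}} := [set tideal e | e in idems].
Definition idem_lt (e f : M) : bool := [&& e * f == e, f * e == e & e != f].

Definition rectangular : Prop :=
  forall e f g : M, idem e -> idem f -> idem g ->
    tideal f = tideal e -> tideal g = tideal e ->
    idem (f * g) && (tideal (f * g) == tideal e).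
Definition regular : Prop := forall m : M, exists n : M, m = m * n * m.
Definition orthogroup : Prop := rectangular /\ regular.

Definition corner (e : M) : {set M} := [set e * m * e | m : M].
Definition maxsub (e : M) : {set M} :=
  [set g in corner e | [exists h in corner e, (g * h == e) && (h * g == e)]].
Definition ginv (e g : M) : M :=
  odflt e [pick h in corner e | (g * h == e) && (h * g == e)].

Definition Lclass (m : M) : {set M} := [set n | lideal n == lideal m].
End Monoid.

Section Reps.
Variable k : fieldType.
Variable M : fmonoid.

Definition is_mrep n (rho : M -> 'M[k]_n) : Prop :=
  (forall x y : M, rho (mmul x y) = rho x *m rho y) /\ rho (mone M) = 1%:M.

Definition is_grep (e : M) n (rho : M -> 'M[k]_n) : Prop :=
  (forall g h, g \in maxsub e -> h \in maxsub e -> rho (mmul g h) = rho g *m rho h)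
  /\ rho e = 1%:M.

(* irreducibility of the family of matrices rho x, x in A (acting on column
   vectors; W^T is a subspace spanned by the rows of W) *)
Definition irr_on (A : {set M}) n (rho : M -> 'M[k]_n) : Prop :=
  (0 < n)%N /\
  forall W : 'M[k]_n, (forall x, x \in A -> (W *m (rho x)^T <= W)%MS) ->
     \rank W = 0%N \/ \rank W = n.

(* absolute irreducibility (as in MathComp's mx_absolutely_irreducible):
   the matrices rho x span the full matrix algebra *)
Definition abs_irr n (rho : M -> 'M[k]_n) : Prop :=
  (0 < n)%N /\ row_full (\matrix_(i < #|M|) mxvec (rho (enum_val i))).

Definition splits : Prop :=
  forall n (rho : M -> 'M[k]_n), is_mrep rho -> irr_on [set: M] rho -> abs_irr rho.

Definition lift (e : M) n (rho : M -> 'M[k]_n) (m : M) : 'M[k]_n :=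
  if tideal e \subset sigma m then rho (mmul (mmul e m) e) else 0.

(* dim Ext^1_{kM}(S, T): derivations modulo inner derivations;
   Ext^1(S,T) classifies extensions 0 -> T -> E -> S -> 0 *)
Definition der_map a b (rS : M -> 'M[k]_a) (rT : M -> 'M[k]_b)
  (d : {ffun M -> 'M[k]_(b, a)}) : {ffun M * M -> 'M[k]_(b, a)} :=
  [ffun p : M * M => d (mmul p.1 p.2) - rT p.1 *m d p.2 - d p.1 *m rS p.2].
Definition inner_map a b (rS : M -> 'M[k]_a) (rT : M -> 'M[k]_b)
  (X : 'M[k]_(b, a)) : {ffun M -> 'M[k]_(b, a)} :=
  [ffun m => rT m *m X - X *m rS m].
Definition dimExt1 a b (rS : M -> 'M[k]_a) (rT : M -> 'M[k]_b) : nat :=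
  (\dim (lker (linfun (der_map rS rT))) - \dim (limg (linfun (inner_map rS rT))))%N.

Definition arrows (e : M) nU (rU : M -> 'M[k]_nU) (f : M) nV (rV : M -> 'M[k]_nV)
  : nat := dimExt1 (lift e rU) (lift f rV).
End Reps.

(* a G_X-module regarded as a G_X^op-module via g |-> g^{-1} *)
Definition oprep (k : fieldType) (M : fmonoid) (e : M) n (rho : M -> 'M[k]_n)
  : M -> 'M[k]_n := fun g => rho (ginv e g).

Section VXY.
Variable k : fieldType.
Variable M : fmonoid.
Variables eX eY : M.
Local Notation "x * y" := (mmul x y) : monoid_scope.
Local Open Scope monoid_scope.

Definition eYL : {set M} := [set eY * x | x in Lclass eX].

Definition gen_a (x y : M) : bool :=
  [&& x \in eYL, y \in eYL &
   [exists m : M, exists z in Lclass eX,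
      [&& tideal eX \subset sigma m, x == eY * m * z & y == eY * m * eY * z]]].
Definition gen_b (x y : M) : bool :=
  [&& x \in eYL, y \in eYL, eX * x == eX * y &
   [exists e in corner eY, [&& idem e, tideal eX \proper sigma e, e != eY,
       e * x == x & e * y == y]]].
Definition gen (x y : M) : bool := gen_a x y || gen_b x y.
Definition equivXY (x y : M) : bool :=
  connect (fun u v => gen u v || gen v u) x y.

(* k[e_Y L_{e_X} / equiv] realised inside k^M: [x] is the indicator of the class of x *)
Definition cls (x : M) : {ffun M -> k^o} :=
  [ffun z => ((z \in eYL) && equivXY x z)%:R].

Definition VXY : {vspace {ffun M -> k^o}} :=
  <<[seq cls x - cls (eX * x) | x <- enum (eYL :\: maxsub eX)%SET]>>%VS.

(* action of (g,h) in G_Y x G_X: [x] |-> [g x h^{-1}] *)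
Definition actXY (g h : M) (f : {ffun M -> k^o}) : {ffun M -> k^o} :=
  [ffun z => if z \in eYL then f (ginv eY g * z * h) else 0].

Definition in_GYX (p : M * M) : bool := (p.1 \in maxsub eY) && (p.2 \in maxsub eX).

(* space of G_Y x G_X-homomorphisms from a module (k^d, rW) into V_{X,Y};
   phi is given by the images of the standard basis vectors *)
Definition hom_map d (rW : M * M -> 'M[k]_d)
  (phi : {ffun 'I_d -> subvs_of VXY}) : {ffun M * M -> {ffun 'I_d -> {ffun M -> k^o}}} :=
  [ffun p => [ffun j => if in_GYX p then
       actXY p.1 p.2 (vsval (phi j)) - \sum_i rW p i j *: vsval (phi i) else 0]].
Definition dimHomXY d (rW : M * M -> 'M[k]_d) : nat := \dim (lker (linfun (hom_map rW))).

Definition end_map d (rW : M * M -> 'M[k]_d) (A : 'M[k]_d) : {ffun M * M -> 'M[k]_d} :=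
  [ffun p => if in_GYX p then A *m rW p - rW p *m A else 0].
Definition dimEndXY d (rW : M * M -> 'M[k]_d) : nat := \dim (lker (linfun (end_map rW))).

(* multiplicity of the irreducible G_Y x G_X-module W in the (semisimple)
   module V_{X,Y} *)
Definition multXY d (rW : M * M -> 'M[k]_d) : nat := (dimHomXY rW %/ dimEndXY rW)%N.

Definition tens_dual nV (rV : M -> 'M[k]_nV) nU (rU : M -> 'M[k]_nU)
  : M * M -> 'M[k]_(nV * nU) :=
  fun p => tensmx (rV p.1) (rU (ginv eX p.2))^T.
End VXY.

(* Main.v *)
Require Import Defs.
From HB Require Import structures.
From mathcomp Require Import all_boot all_order all_algebra.
From mathcomp Require Import all_fingroup.
From mathcomp Require Import mxtens zify.
Set Implicit Arguments. Unset Strict Implicit. Unset Printing Implicit Defensive.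
Import GRing.Theory.
Local Open Scope ring_scope.

(** Ext^1(U,V) is computed as derivations d : M -> Hom(U,V) modulo inner ones.
    Since M is regular, d vanishes at every m acting as zero on both modules.
    If X = Y, averaging over G_X makes d vanish on G_X, hence everywhere; if X
    and Y are incomparable, an inner derivation kills d(e_X), and then d = 0.

    If e_X < e_Y, average over G_Y so that d = 0 on G_Y.  Then d is determined by
    its restriction f to e_Y L_{e_X}, through d(m) = f(e_Y m e_X) - T(m) f(e_X) for
    m above X, and the restrictions are exactly the G_Y x G_X-equivariant maps
    that are constant on the classes of the equivalence; the inner ones among
    these derivations come from Hom_{G_Y}(U,V).  Hence
      dim Ext^1(U,V) = dim Map_G(classes, Hom(U,V)) - dim Hom_{G_Y}(U,V).
    Both terms are spaces of equivariant maps on a finite G-set, so by averaging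
    the trace pairing they keep their dimension when U and V are replaced by their
    contragredients.  Coordinates identify Hom_G(V (x) U^*, V_{X,Y}) with the
    kernel of the sum over the fibre of x |-> e_X x above e_X, which maps the
    contragredient Map_G onto the contragredient Hom_{G_Y}; this gives (2).
    Transposition turns Ext^1_M(U,V) into Ext^1 over the opposite monoid between
    the linear duals of V and U, which differ from the modules in (3) by passing
    to contragredients; the same invariance gives (3). *)

Local Notation "x ** y" := (mmul x y) (at level 40, left associativity).

(** * Finite monoids and orthogroups *)

Section FiniteMonoid.
Variable M : fmonoid.
Implicit Types (a b e f g m x y z : M).

Lemma mpowS m n : mpow m n.+1 = m ** mpow m n.
Proof. by case: n => //=; rewrite mmulm1. Qed.

Lemma mpowD m i j : mpow m (i + j) = mpow m i ** mpow m j.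
Proof.
by elim: i => [|i IH]; rewrite ?mmul1m // addSn !mpowS IH mmulA.
Qed.

Lemma mpowSr m n : mpow m n.+1 = mpow m n ** m.
Proof. by rewrite -addn1 mpowD. Qed.

Lemma mpow_absorb g m n : g ** m = m -> (0 < n)%N -> g ** mpow m n = mpow m n.
Proof. by case: n => // n gm _; rewrite mpowS mmulA gm. Qed.

Lemma mpow_absorbr g m n : m ** g = m -> (0 < n)%N -> mpow m n ** g = mpow m n.
Proof. by case: n => // n gm _; rewrite mpowSr -mmulA gm. Qed.

(** Two of the powers m, ..., m^(|M|+1) coincide, so the powers are eventually periodic and one with
    exponent between 1 and |M| is idempotent. The default value in [omega] is therefore never
    reached. *)
Lemma omega_spec m : idem (omega m) /\ exists2 n, (0 < n)%N & omega m = mpow m n.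
Proof.
rewrite /omega; case: pickP => [e /andP[ide /existsP[n /andP[n0 /eqP def_e]]]|none] /=.
  by split=> //; exists n.
pose f (i : 'I_(#|M|.+1)) := mpow m i.+1.
have /injectivePn [i [j neq_ij eq_ij]] : ~~ injectiveb f.
  apply/negP => /injectiveP /leq_card; rewrite card_ord; lia.
wlog lt_ij : i j neq_ij eq_ij / (i < j)%N.
  move=> W; have := neq_ij; rewrite -val_eqE neq_ltn => /orP[]; first exact: W.
  by apply: W; rewrite // eq_sym.
set p := (j - i)%N; have p0 : (0 < p)%N by lia.
have periodic q : (i < q)%N -> mpow m (q + p) = mpow m q.
  move=> lt_iq; have -> : q = (q - i.+1 + i.+1)%N by lia.
  rewrite -addnA !mpowD; congr (_ ** _); rewrite -mpowD.
  by rewrite -[RHS]/(f i) eq_ij; congr mpow; lia.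
have periodicM q t : (i < q)%N -> mpow m (q + t * p) = mpow m q.
  move=> lt_iq; elim: t => [|t IH]; first by rewrite addn0.
  by rewrite mulSn addnCA [(p + _)%N]addnC periodic // ltn_addr.
(* The multiple of the period p among i + 1, ..., i + p = j: doubling the exponent adds a multiple
   of p, so m^n is idempotent. *)
pose n := ((i + p) %/ p * p)%N.
have le_n : (n <= i + p)%N := leq_divM _ _.
have lt_n : (i < n)%N by have := divn_eq (i + p) p; have := ltn_mod (i + p) p; lia.
have ltn : (n < #|M|.+1)%N by have := ltn_ord j; lia.
have := none (mpow m n); rewrite /idem -mpowD periodicM // eqxx /=.
by move/negbT/existsP; case; exists (Ordinal ltn); rewrite /= eqxx andbT; lia.
Qed.

Lemma idem_omega m : idem (omega m). Proof. by case: (omega_spec m). Qed.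

Lemma omega_pow m : exists2 n, (0 < n)%N & omega m = mpow m n.
Proof. by case: (omega_spec m). Qed.

Lemma idemE e : idem e -> e ** e = e. Proof. by move/eqP. Qed.

Lemma mulK_idem e x : idem e -> x ** e ** e = x ** e.
Proof. by move=> /idemE ee; rewrite -mmulA ee. Qed.

Lemma omega_absorb g m : g ** m = m -> g ** omega m = omega m.
Proof. by case: (omega_pow m) => n n0 -> /mpow_absorb ->. Qed.

Lemma omega_absorbr g m : m ** g = m -> omega m ** g = omega m.
Proof. by case: (omega_pow m) => n n0 -> /mpow_absorbr ->. Qed.

(** The J-order on elements; in an orthogroup [jge e m] is the condition that sigma(m) contains
    MeM. *)
Definition jge e m : bool := e \in tideal m.

Lemma jgeP e m : reflect (exists a b, e = a ** m ** b) (jge e m).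
Proof.
apply: (iffP imset2P) => [[a b _ _ ->]|[a [b ->]]]; first by exists a, b.
exact: (Imset2spec (x1 := a) (x2 := b)).
Qed.

Lemma jge_refl m : jge m m.
Proof. by apply/jgeP; exists (mone M), (mone M); rewrite mmul1m mmulm1. Qed.

Lemma jge_trans e f m : jge e f -> jge f m -> jge e m.
Proof.
move=> /jgeP[a [b ->]] /jgeP[c [d ->]].
by apply/jgeP; exists (a ** c), (d ** b); rewrite !mmulA.
Qed.

Lemma jge_mull x y : jge (x ** y) x.
Proof. by apply/jgeP; exists (mone M), y; rewrite mmul1m. Qed.

Lemma jge_mulr x y : jge (x ** y) y.
Proof. by apply/jgeP; exists x, (mone M); rewrite mmulm1. Qed.

Lemma tideal_sub e m : (tideal e \subset tideal m) = jge e m.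
Proof.
apply/subsetP/idP => [sub|em x /jge_trans]; last exact.
exact/sub/jge_refl.
Qed.

Lemma tideal_eqP e f : tideal e = tideal f <-> jge e f /\ jge f e.
Proof.
rewrite -!tideal_sub; split=> [->|[ef fe]]; first by rewrite subxx.
by apply/eqP; rewrite eqEsubset ef fe.
Qed.

Lemma jge_one e : jge e (mone M).
Proof. by apply/jgeP; exists e, (mone M); rewrite !mmulm1. Qed.

(* With e = a g b, u = e a g and v = g b e satisfy u v = e, and finiteness of M turns e into a power of v, which lies in g M. *)
Lemma idem_stable e g : idem e -> idem g -> g ** e = g -> e ** g = g -> jge e g ->
  g = e.
Proof.
move=> /idemE ee /idemE gg ge eg /jgeP[a [b def_e]].
set v := g ** b ** e; set u := e ** a ** g.
have uv : u ** v = e.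
  rewrite /u /v !mmulA -(mmulA (e ** a)) gg.
  by rewrite -!mmulA [a ** _]mmulA [_ ** (b ** e)]mmulA -def_e ee ee.
have ev : e ** v = v by rewrite /v !mmulA eg.
have gv : g ** v = v by rewrite /v !mmulA gg.
have uvn n : (0 < n)%N -> mpow u n ** mpow v n = e.
  elim: n => // -[_ _|n IH _]; first by rewrite /= uv.
  rewrite mpowSr [mpow v _]mpowS mmulA -(mmulA _ u) uv -mmulA.
  by rewrite (mpow_absorb ev) // IH.
have [n n0 vn] := omega_pow v.
have ve : omega v = e.
  rewrite -(omega_absorb ev) -{1}(uvn n n0) -vn -mmulA.
  by rewrite (idemE (idem_omega v)) vn uvn.
by rewrite -ge -{1}ve (omega_absorb gv) ve.
Qed.

(** From m = a m c with c = m b follows m = a^n m c^n, so c^omega fixes m on the right. Since c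
    begins with m, this puts m in m m M, and iterating gives m^omega m = m. *)
Lemma mul_omega m : jge m (m ** m) -> m ** omega m = m.
Proof.
move=> /jgeP[a [b def_m]].
have [c def_c] : exists c, c = m ** b by exists (m ** b).
have amc : m = a ** m ** c by rewrite {1}def_m def_c !mmulA.
have mc n : m = mpow a n ** m ** mpow c n.
  elim: n => [|n IH]; first by rewrite mmul1m mmulm1.
  by rewrite mpowSr mpowS !mmulA -(mmulA (mpow a n)) -(mmulA (mpow a n)) -amc.
have [n n0 cn] := omega_pow c.
have mcn : m ** omega c = m.
  by rewrite {1 2}(mc n) -cn mulK_idem // idem_omega.
(* Chosen so that m c' = c^n = c^omega. *)
pose c' := b ** mpow c n.-1.
have mmc : m ** m ** c' = m.
  rewrite -[RHS]mcn cn -(prednK n0) mpowS {1}def_c /c' !mmulA //.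
have mmcj j : mpow m j ** m ** mpow c' j = m.
  elim: j => [|j IH]; first by rewrite mmul1m mmulm1.
  transitivity (m ** (mpow m j ** m ** mpow c' j) ** c'); last by rewrite IH.
  by rewrite mpowS mpowSr !mmulA.
have [j j0 mj] := omega_pow m.
have wm : omega m ** m = m.
  by rewrite -{2 3}(mmcj j) -mj !mmulA (idemE (idem_omega m)).
by rewrite -[RHS]wm mj -mpowS -mpowSr.
Qed.

End FiniteMonoid.

(** * The J-order and the maximal subgroups of an orthogroup *)

Section Orthogroup.
Variable M : fmonoid.
Hypothesis orthoM : orthogroup M.
Implicit Types (a b e f g m x y z : M).

Lemma idemM e f g : idem e -> idem f -> idem g -> jge e f -> jge f e -> jge e g ->
  jge g e -> idem (f ** g) /\ jge e (f ** g).
Proof.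
move=> ide idf idg ef fe eg ge.
have /andP[-> /eqP/tideal_eqP[_ ->]] //: idem (f ** g) && (tideal (f ** g) == tideal e).
by case: orthoM => rectM _; apply: rectM => //; apply/tideal_eqP.
Qed.

(** The product e f e is idempotent by rectangularity, lies in the J-class of e and is fixed by e on
    both sides, so stability makes it e. *)
Lemma idem_sandwich e f : idem e -> idem f -> jge e f -> jge f e -> e ** f ** e = e.
Proof.
move=> ide idf ef fe; have ee := jge_refl e.
have [idef eef] := idemM ide ide idf ee ee ef fe.
have [idefe eefe] := idemM ide idef ide eef (jge_mull _ _) ee ee.
by apply: idem_stable; rewrite // ?mulK_idem // !mmulA (idemE ide).
Qed.

(** The idempotents of a J-class form a rectangular band: expand g as g f g, then contract f (e g) f
    to f. *)
Lemma idem_middle e f g : idem e -> idem f -> idem g -> jge e f -> jge f e ->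
  jge e g -> jge g e -> f ** e ** g = f ** g.
Proof.
move=> ide idf idg ef fe eg ge.
have [ideg eeg] := idemM ide ide idg (jge_refl e) (jge_refl e) eg ge.
have fgf := idem_sandwich idg idf (jge_trans ge ef) (jge_trans fe eg).
rewrite -{1}fgf !mmulA.
have := idem_sandwich idf ideg (jge_trans fe eeg) (jge_trans (jge_mull _ _) ef).
by rewrite !mmulA => ->.
Qed.

(** If m = m n m, the idempotents n m and m n lie in the J-class of m, hence so does n m m n. Thus m
    is J-below m m, and [mul_omega] applies. *)
Lemma mul_omegaK m : m ** omega m = m.
Proof.
case: orthoM => rectM regM; have [n def_m] := regM m.
have idmn : idem (m ** n) by rewrite /idem !mmulA -def_m.
have idnm : idem (n ** m) by rewrite /idem !mmulA -(mmulA n) -(mmulA n) -def_m.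
have mnm : jge m (n ** m) by rewrite {1}def_m -mmulA jge_mulr.
have mmn : jge m (m ** n) by rewrite {1}def_m jge_mull.
have [_ h] := idemM idnm idnm idmn (jge_refl _) (jge_refl _)
  (jge_trans (jge_mulr _ _) mmn) (jge_trans (jge_mull _ _) mnm).
apply: mul_omega; apply: (jge_trans mnm); apply: (jge_trans h).
by apply/jgeP; exists n, n; rewrite !mmulA.
Qed.

Lemma omega_mulK m : omega m ** m = m.
Proof.
by have [n _ mn] := omega_pow m; rewrite mn -mpowSr mpowS -mn mul_omegaK.
Qed.

Lemma jge_omega e m : jge e (omega m) = jge e m.
Proof.
apply/idP/idP => /jge_trans; apply.
  by have [n n0 ->] := omega_pow m; rewrite -(prednK n0) mpowS jge_mull.
by rewrite -{1}(mul_omegaK m) jge_mulr.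
Qed.

Lemma sigma_sub e m : (tideal e \subset sigma m) = jge e m.
Proof. by rewrite tideal_sub jge_omega. Qed.

Lemma sigmaE m : sigma m = tideal m.
Proof. by apply/tideal_eqP; rewrite jge_omega jge_refl -jge_omega jge_refl. Qed.

(** If e = x a y = u b v, then p = y e x a and q = b v e u are idempotents in the J-class of e. By
    rectangularity p q is J-above e, and p q lies in M a b M. *)
Lemma jgeM e a b : idem e -> jge e (a ** b) = jge e a && jge e b.
Proof.
move=> ide; apply/idP/andP => [eab|[/jgeP[x [y ea]] /jgeP[u [v eb]]]].
  by split; apply: jge_trans eab _; rewrite (jge_mull, jge_mulr).
have ee := idemE ide.
set p := y ** e ** x ** a; set q := b ** v ** e ** u.
have idp : idem p.
  rewrite /idem /p; apply/eqP; rewrite !mmulA.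
  by rewrite -(mmulA (y ** e)) -(mmulA (y ** e)) -ea !mulK_idem // mmulA.
have idq : idem q.
  rewrite /idem /q; apply/eqP; rewrite !mmulA.
  by rewrite -(mmulA (b ** v ** e)) -(mmulA (b ** v ** e)) -eb !mulK_idem // mmulA.
have pe : jge p e by apply/jgeP; exists y, (x ** a); rewrite /p !mmulA.
have qe : jge q e by apply/jgeP; exists (b ** v), u; rewrite /q.
have ep : jge e p.
  apply/jgeP; exists (x ** a), y; rewrite /p !mmulA -ea ee.
  by rewrite -(mmulA e) -(mmulA e) -ea ee.
have eq : jge e q.
  apply/jgeP; exists u, (b ** v); rewrite /q !mmulA -eb ee.
  by rewrite -(mmulA e) -(mmulA e) -eb ee.
have [_ h] := idemM ide idp idq ep pe eq qe.
apply: jge_trans h _; apply/jgeP; exists (y ** e ** x), (v ** e ** u).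
by rewrite /p /q !mmulA.
Qed.

Lemma jge_idem_eq e m : idem e -> e ** m = m -> m ** e = m -> jge e m -> omega m = e.
Proof.
move=> ide em me e_m; apply: idem_stable => //; rewrite ?idem_omega //.
- exact: omega_absorbr.
- exact: omega_absorb.
- by rewrite jge_omega.
Qed.

(** An element of e M e that is J-above e has e as its idempotent power, so one of its powers
    inverts it. *)
Lemma maxsubP e g : idem e ->
  reflect [/\ e ** g = g, g ** e = g & jge e g] (g \in maxsub e).
Proof.
move=> ide; have ee := idemE ide; apply: (iffP idP) => [|[eg ge e_g]]; rewrite !inE.
  case/andP=> /imsetP[m _ ->] /existsP[h /and3P[_ /eqP def_e _]].
  split; first by rewrite !mmulA ee.
    by rewrite mulK_idem.
  by rewrite -[X in jge X]def_e jge_mull.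
have [n n0 gn] := omega_pow g.
have we := jge_idem_eq ide eg ge e_g.
have corn m : e ** m = m -> m ** e = m -> m \in corner e.
  by move=> em me; apply/imsetP; exists m; rewrite // em me.
(* The exponent n - 1 alone could be 0, and g^0 = 1 need not lie in e M e; adding n, where g^n = e,
   avoids this. *)
rewrite corn //=; apply/existsP; exists (mpow g (n.-1 + n)); apply/and3P; split.
- apply: corn; [apply: mpow_absorb | apply: mpow_absorbr] => //; lia.
- by rewrite -mpowS -addSn prednK // mpowD -gn we ee.
- by rewrite -mpowSr -addSn prednK // mpowD -gn we ee.
Qed.

Lemma ginvP e g : idem e -> g \in maxsub e ->
  [/\ ginv e g \in maxsub e, g ** ginv e g = e & ginv e g ** g = e].
Proof.
move=> ide gG; rewrite /ginv; case: pickP => [h /and3P[hc /eqP gh /eqP hg]|none] /=.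
  split=> //; apply/maxsubP => //; case/imsetP: hc hg => m _ -> hg.
  by rewrite mulK_idem // !mmulA (idemE ide); split=> //; rewrite -[X in jge X]hg jge_mull.
move: gG; rewrite inE => /andP[_ /existsP[h]].
by have := none h; rewrite /= => ->.
Qed.

Lemma maxsub_corner e m : idem e -> jge e m -> e ** m ** e \in maxsub e.
Proof.
move=> ide em; apply/maxsubP => //; split; first by rewrite !mmulA (idemE ide).
  by rewrite mulK_idem.
by rewrite !jgeM // jge_refl em.
Qed.

Lemma maxsub_id e : idem e -> e \in maxsub e.
Proof. by move=> ide; apply/maxsubP; rewrite ?(idemE ide) // jge_refl. Qed.

Lemma maxsubM e g h : idem e -> g \in maxsub e -> h \in maxsub e ->
  g ** h \in maxsub e.
Proof.
move=> ide /(maxsubP _ ide)[eg ge jg] /(maxsubP _ ide)[eh he jh].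
by apply/maxsubP => //; rewrite jgeM // jg jh -mmulA he mmulA eg.
Qed.

Lemma mul_insert e a b : idem e -> jge a e -> jge e a -> jge b e -> jge e b ->
  a ** e ** b = a ** b.
Proof.
move=> ide ae ea be eb.
rewrite -[in LHS](mul_omegaK a) -[in LHS](omega_mulK b) !mmulA.
have wle x : jge x e -> jge (omega x) e.
  by move=> xe; apply: jge_trans xe; rewrite -jge_omega jge_refl.
rewrite -2!(mmulA a) (@idem_middle e (omega a) (omega b)) ?idem_omega ?jge_omega ?wle //.
by rewrite mmulA mul_omegaK -mmulA omega_mulK.
Qed.

(** On the elements above e the map m to e m e is multiplicative; this is why a G_e-module inflates
    to an M-module. *)
Lemma cornerM e a b : idem e -> jge e a -> jge e b ->
  e ** a ** b ** e = e ** a ** e ** b ** e.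
Proof.
move=> ide ea eb.
have := mul_insert (a := e ** a) (b := b ** e) ide (jge_mull _ _).
rewrite !jgeM // jge_refl ea eb => /(_ isT (jge_mulr _ _) isT).
by rewrite !mmulA.
Qed.

(** If x e = x and x is above e, then e x = e x e is invertible in G_e, so e lies in M x. *)
Lemma LclassP e x : idem e -> (x \in Lclass e) = (x ** e == x) && jge e x.
Proof.
move=> ide; rewrite inE; apply/eqP/andP => [Lx|[/eqP xe ex]].
  have /imsetP[a _ xae] : x \in lideal e.
    by rewrite -Lx; apply/imsetP; exists (mone M); rewrite ?mmul1m.
  have /imsetP[b _ ebx] : e \in lideal x.
    by rewrite Lx; apply/imsetP; exists (mone M); rewrite ?mmul1m.
  by rewrite xae mulK_idem // eqxx -xae {1}ebx jge_mulr.
have exG : e ** x \in maxsub e by rewrite -xe mmulA maxsub_corner.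
have [_ _ hx] := ginvP ide exG.
apply/setP=> y; apply/imsetP/imsetP => -[a _ ->].
  by exists (a ** x); rewrite // -mmulA xe.
by exists (a ** (ginv e (e ** x) ** e)); rewrite // -!mmulA hx.
Qed.

End Orthogroup.

(** * Derivations and modules supported at an idempotent *)

Section LinearAlgebra.
Variable k : fieldType.

(** The maps in the definitions are bare functions; this evaluates [linfun] on them from a separate
    proof of linearity. *)
Lemma linfun_apply (V W : vectType k) (f : V -> W) : linear f -> linfun f =1 f.
Proof.
move=> lf; pose F : {linear V -> W} := HB.pack f (GRing.isLinear.Build k V W *:%R f lf).
exact: (lfunE F).
Qed.

(* A pairing that is nondegenerate on the left embeds E1 into the dual of E2. *)
Lemma dim_le_pairing (V W : vectType k) (E1 : {vspace V}) (E2 : {vspace W})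
    (beta : V -> W -> k^o) :
  (forall v, linear (beta v)) -> (forall w, linear (fun v => beta v w)) ->
  (forall v, v \in E1 -> (forall w, w \in E2 -> beta v w = 0) -> v = 0) ->
  (\dim E1 <= \dim E2)%N.
Proof.
move=> linr linl nondeg.
pose A v := \row_(i < \dim E2) (beta v (vbasis E2)`_i : k).
have linA : linear A.
  by move=> a u v; apply/rowP => i; rewrite !mxE (linl (vbasis E2)`_i a u v).
have /limg_dim_eq <- : (E1 :&: lker (linfun A) = 0)%VS.
  apply/eqP; rewrite -subv0; apply/subvP => v; rewrite memv_cap memv_ker memv0.
  case/andP=> E1v /eqP; rewrite (linfun_apply linA) => Av0; apply/eqP.
  apply: nondeg => // w /coord_vbasis ->.
  pose F : {linear W -> k^o} := HB.pack (beta v)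
    (GRing.isLinear.Build k W k^o *:%R (beta v) (linr v)).
  rewrite -[beta v _]/(F _) linear_sum big1 // => i _; rewrite linearZ /=.
  by have /rowP/(_ i) := Av0; rewrite !mxE => ->; rewrite scaler0.
by rewrite (leq_trans (dimvS (subvf _))) // dimvf /dim /= mul1n.
Qed.

End LinearAlgebra.

Section Derivations.
Variables (k : fieldType) (M : fmonoid).

Section Maps.
Variables (a b : nat) (S : M -> 'M[k]_a) (T : M -> 'M[k]_b).

Definition derivation (d : {ffun M -> 'M[k]_(b, a)}) : Prop :=
  forall m n, d (m ** n) = T m *m d n + d m *m S n.

Lemma der_map_linear : linear (der_map S T).
Proof.
move=> c u v; apply/ffunP => p; rewrite !ffunE mulmxDr mulmxDl -scalemxAr -scalemxAl.
by rewrite !opprD !scalerBr [X in X + _ = _]addrACA [LHS]addrACA.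
Qed.

Lemma inner_map_linear : linear (inner_map S T).
Proof.
move=> c u v; apply/ffunP => p; rewrite !ffunE mulmxDr mulmxDl -scalemxAr -scalemxAl.
by rewrite scalerBr opprD addrACA.
Qed.

Lemma der_mapP d : reflect (derivation d) (d \in lker (linfun (der_map S T))).
Proof.
rewrite memv_ker (linfun_apply der_map_linear); apply: (iffP eqP) => [d0 m n|der].
  by have /ffunP/(_ (m, n)) := d0; rewrite !ffunE /= -addrA -opprD => /subr0_eq.
by apply/ffunP => -[m n]; rewrite !ffunE /= der -addrA -opprD subrr.
Qed.

Lemma inner_mapP d : reflect (exists X, d = inner_map S T X) (d \in limg (linfun (inner_map S T))).
Proof.
apply: (iffP memv_imgP) => [[X _ ->]|[X ->]]; exists X; rewrite ?memvf //;
by rewrite (linfun_apply inner_map_linear).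
Qed.

Lemma inner_derivation X : is_mrep S -> is_mrep T -> derivation (inner_map S T X).
Proof.
move=> [SM _] [TM _] m n; rewrite !ffunE SM TM mulmxBr mulmxBl !mulmxA.
by rewrite addrA subrK.
Qed.

Lemma dimExt1_eq0 : (forall d, derivation d -> exists X, d = inner_map S T X) ->
  dimExt1 S T = 0%N.
Proof.
move=> inner; apply/eqP; rewrite subn_eq0; apply: dimvS.
by apply/subvP => d /der_mapP/inner/inner_mapP.
Qed.

End Maps.

(** The properties of [lift] used below. Unlike [lift] itself, they pass visibly to contragredients,
    to transposes and to other idempotents of the same J-class. *)
Definition rep_at (e : M) n (rho : M -> 'M[k]_n) : Prop :=
  [/\ is_mrep rho, forall m, ~~ jge e m -> rho m = 0 & rho e = 1%:M].

Hypothesis orthoM : orthogroup M.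

Lemma lift_rep_at e n (rho : M -> 'M[k]_n) : idem e -> is_grep e rho ->
  rep_at e (Defs.lift e rho).
Proof.
move=> ide [rhoM rho1]; have ee := idemE ide.
have liftE m : Defs.lift e rho m = if jge e m then rho (e ** m ** e) else 0.
  by rewrite /Defs.lift sigma_sub.
split; first split=> [x y|].
- rewrite !liftE jgeM //; case: (boolP (jge e x)) => ex; last by rewrite mul0mx.
  case: (boolP (jge e y)) => ey; last by rewrite mulmx0.
  by rewrite mmulA cornerM // -rhoM ?maxsub_corner // !mmulA mulK_idem.
- by rewrite liftE jge_one mmulm1 ee rho1.
- by move=> m /negbTE em; rewrite liftE em.
- by rewrite liftE jge_refl !ee rho1.
Qed.

Lemma lift_maxsub e n (rho : M -> 'M[k]_n) g : idem e -> g \in maxsub e ->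
  Defs.lift e rho g = rho g.
Proof.
by move=> ide /(maxsubP orthoM _ ide)[eg ge jg]; rewrite /Defs.lift sigma_sub // jg eg ge.
Qed.

Section RepAt.
Variables (e : M) (n : nat) (rho : M -> 'M[k]_n).
Hypotheses (ide : idem e) (rho_e : rep_at e rho).

Lemma rep_atM x y : rho (x ** y) = rho x *m rho y.
Proof. by case: rho_e => -[]. Qed.

Lemma rep_at_id : rho e = 1%:M.
Proof. by case: rho_e. Qed.

Lemma rep_at0 m : ~~ jge e m -> rho m = 0.
Proof. by case: rho_e => _ rho0 _; apply: rho0. Qed.

(** The element e f e is an idempotent of the group G_e, hence equals e. *)
Lemma rep_at_idem f : idem f -> jge e f -> rho f = 1%:M.
Proof.
move=> idf ef; have ee := idemE ide.
have idefe : idem (e ** f ** e).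
  apply/eqP; rewrite !mmulA mulK_idem // -(cornerM orthoM ide ef ef).
  by rewrite mulK_idem.
have efe : e ** f ** e = e.
  apply: idem_stable; rewrite ?mulK_idem // ?mmulA ?ee //.
  by have /(maxsubP orthoM _ ide)[] := maxsub_corner orthoM ide ef.
by rewrite -rep_at_id -efe !rep_atM rep_at_id mul1mx mulmx1.
Qed.

Lemma rep_at_conj f : idem f -> tideal e = tideal f -> rep_at f rho.
Proof.
move=> idf /tideal_eqP[ef fe]; split; first by case: rho_e.
  by move=> m fm; apply: rep_at0; apply: contra fm; apply: jge_trans.
exact: rep_at_idem.
Qed.

Lemma rep_at_unit m : jge e m -> rho m \in unitmx.
Proof.
move=> em; have [_ gh _] := ginvP orthoM ide (maxsub_corner orthoM ide em).
have : rho (e ** m ** e ** ginv e (e ** m ** e)) = 1%:M by rewrite gh rep_at_id.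
by rewrite !rep_atM rep_at_id mul1mx mulmx1 => /mulmx1_unit[].
Qed.

Lemma rep_at_ginv g : g \in maxsub e -> rho (ginv e g) = invmx (rho g).
Proof.
move=> gG; have [_ gh _] := ginvP orthoM ide gG.
have [_ _ /rep_at_unit ug] := maxsubP orthoM _ ide gG.
by rewrite -[LHS](mulKmx ug) -rep_atM gh rep_at_id mulmx1.
Qed.

End RepAt.

Definition rep_dual e n (rho : M -> 'M[k]_n) m : 'M[k]_n :=
  if jge e m then (invmx (rho m))^T else 0.

Lemma rep_dual_rep_at e n (rho : M -> 'M[k]_n) : idem e -> rep_at e rho ->
  rep_at e (rep_dual e rho).
Proof.
move=> ide re; split; first split=> [x y|].
- rewrite /rep_dual jgeM //; case: (boolP (jge e x)) => ex; last by rewrite mul0mx.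
  case: (boolP (jge e y)) => ey; last by rewrite mulmx0.
  rewrite -trmx_mul; congr _^T; rewrite (rep_atM re).
  have [ux uy] := (rep_at_unit ide re ex, rep_at_unit ide re ey).
  have uxy : rho x *m rho y \in unitmx by rewrite unitmx_mul ux.
  by rewrite -[RHS](mulKmx uxy) -mulmxA (mulKVmx uy) mulmxV // mulmx1.
- rewrite /rep_dual jge_one; case: re => -[_ ->] _ _.
  by rewrite invmx1 trmx1.
- by move=> m /negbTE em; rewrite /rep_dual em.
- by rewrite /rep_dual jge_refl (rep_at_id re) invmx1 trmx1.
Qed.

(* Representations supported at e are determined on G_e, where this says that rho' is the contragredient of rho. *)
Definition contragredient e n (rho rho' : M -> 'M[k]_n) : Prop :=
  forall m, jge e m -> (rho' m)^T *m rho m = 1%:M.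

Lemma rep_dual_contragredient e n (rho : M -> 'M[k]_n) : idem e -> rep_at e rho ->
  contragredient e rho (rep_dual e rho).
Proof.
by move=> ide re m em; rewrite /rep_dual em trmxK mulVmx // (rep_at_unit ide re).
Qed.

End Derivations.

(** * The maximal subgroup as a finite group *)

Section UnitGroup.
Variable M : fmonoid.

(** The two proofs are parameters of the type so that the group structure, whose axioms need them,
    can be attached to it. *)
Definition units_at (orthoM : orthogroup M) (e : M) (ide : idem e) : Type :=
  {g : M | g \in maxsub e}.

Variables (orthoM : orthogroup M) (e : M) (ide : idem e).
HB.instance Definition _ := Finite.on (units_at orthoM ide).
Implicit Types g h : units_at orthoM ide.

Lemma ginv_maxsub g : ginv e (val g) \in maxsub e.
Proof. by case: (ginvP orthoM ide (valP g)). Qed.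

Definition units_mul g h : units_at orthoM ide :=
  exist _ (val g ** val h) (maxsubM orthoM ide (valP g) (valP h)).
Definition units_one : units_at orthoM ide := exist _ e (maxsub_id orthoM ide).
Definition units_inv g : units_at orthoM ide := exist _ (ginv e (val g)) (ginv_maxsub g).

Lemma units_mulA : associative units_mul.
Proof. by move=> g h l; apply: val_inj; rewrite /= mmulA. Qed.
Lemma units_mul1 : left_id units_one units_mul.
Proof. by move=> g; apply: val_inj => /=; case/(maxsubP orthoM _ ide): (valP g). Qed.
Lemma units_mulV : left_inverse units_one units_inv units_mul.
Proof. by move=> g; apply: val_inj => /=; case: (ginvP orthoM ide (valP g)). Qed.

HB.instance Definition _ := Finite_isGroup.Build (units_at orthoM ide)
  units_mulA units_mul1 units_mulV.

Lemma card_units_at : #|{: units_at orthoM ide}| = #|maxsub e|.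
Proof. by rewrite card_sig; apply: eq_card => g. Qed.

Lemma units_valM g h : val (g * h)%g = val g ** val h. Proof. by []. Qed.
Lemma units_val1 : val (1%g : units_at orthoM ide) = e. Proof. by []. Qed.
Lemma units_mulVm g : val (g^-1)%g ** val g = e.
Proof. by rewrite -units_valM mulVg. Qed.
Lemma units_mulmV g : val g ** val (g^-1)%g = e.
Proof. by rewrite -units_valM mulgV. Qed.

End UnitGroup.

(** * Derivations modulo inner ones on a maximal subgroup *)

Section Averaging.
Variables (k : fieldType) (M : fmonoid).
Hypothesis orthoM : orthogroup M.
Variables (a b : nat) (S : M -> 'M[k]_a) (T : M -> 'M[k]_b).
Hypotheses (repS : is_mrep S) (repT : is_mrep T).

Lemma derivationB d X : derivation S T d -> derivation S T (d - inner_map S T X).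
Proof. by move=> /der_mapP dZ; apply/der_mapP; rewrite rpredB //; apply/der_mapP/inner_derivation. Qed.

(** Regularity enters here: expand d on m = m (n m), where both T(m) and S(n m) are zero. *)
Lemma derivation_vanish d m : derivation S T d -> S m = 0 -> T m = 0 -> d m = 0.
Proof.
move=> der Sm Tm; have [n def_m] := orthoM.2 m.
by rewrite [in LHS]def_m -mmulA der Tm mul0mx (proj1 repS) Sm !mulmx0 addr0.
Qed.

(** Vanishing of the first cohomology of G_e: with Y the sum of d(g) S(g^-1), reindexing by g to h g
    gives Y S(h) - T(h) Y = |G_e| d(h). *)
Lemma derivation_inner_on_units d e : idem e -> #|maxsub e|%:R != 0 :> k ->
  S e = 1%:M -> T e = 1%:M -> derivation S T d ->
  exists X, forall g, g \in maxsub e -> d g = inner_map S T X g.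
Proof.
move=> ide cardG Se Te der; pose G := units_at orthoM ide.
pose Y := \sum_(g : G) d (val g) *m S (val (g^-1)%g).
exists (- (#|maxsub e|%:R^-1 *: Y)) => h hG; rewrite !ffunE.
suff -> : d h = #|maxsub e|%:R^-1 *: (Y *m S h - T h *m Y).
  by rewrite scalerBr mulmxN mulNmx opprK -scalemxAl -scalemxAr addrC.
pose h' : G := exist _ h hG; have -> : h = val h' by [].
suff -> : Y *m S (val h') - T (val h') *m Y = #|maxsub e|%:R *: d (val h').
  by rewrite scalerA mulVf // scale1r.
have [SM TM] := (proj1 repS, proj1 repT).
rewrite /Y {1}(reindex_inj (mulgI h')) mulmx_suml mulmx_sumr -sumrB.
rewrite (eq_bigr (fun=> d (val h'))); last first.
  move=> g _; rewrite invMg !units_valM der -mulmxA -SM -mmulA units_mulVm.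
  rewrite SM Se mulmx1 mulmxDl mulmxA addrC addKr -mulmxA -SM units_mulmV Se.
  by rewrite mulmx1.
by rewrite sumr_const card_units_at scaler_nat.
Qed.

End Averaging.

(** * Vanishing of Ext^1 for equal or incomparable J-classes *)

Section Vanishing.
Variables (k : fieldType) (M : fmonoid).
Hypothesis orthoM : orthogroup M.
Variables (a b : nat) (S : M -> 'M[k]_a) (T : M -> 'M[k]_b) (e f : M).
Hypotheses (ide : idem e) (idf : idem f) (repS : rep_at e S) (repT : rep_at f T).

Lemma dimExt1_same : tideal e = tideal f -> #|maxsub e|%:R != 0 :> k ->
  dimExt1 S T = 0%N.
Proof.
move=> ef cardG; have repTe := rep_at_conj orthoM idf repT ide (esym ef).
have [[mS _ Se] [mT _ Te]] := (repS, repTe).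
apply: dimExt1_eq0 => d der.
have [X dX] := derivation_inner_on_units orthoM mS mT ide cardG Se Te der.
exists X; apply/eqP; rewrite -subr_eq0; apply/eqP.
have der' := derivationB mS mT X der; set d' := d - _ in der' *.
have d'G g : g \in maxsub e -> d' g = 0.
  by move=> gG; rewrite 2!ffunE dX // subrr.
apply/ffunP => m; rewrite [RHS]ffunE.
have [em|em] := boolP (jge e m); last first.
  by apply: (derivation_vanish orthoM mS der'); [apply: (rep_at0 repS) | apply: (rep_at0 repTe)].
(* As d'(e) = 0 and e acts as the identity on both modules, d'(e m e) = d'(m). *)
have := d'G _ (maxsub_corner orthoM ide em).
by rewrite !der' (d'G _ (maxsub_id orthoM ide)) Te Se mul0mx mulmx0 mul1mx mulmx1 addr0 add0r.
Qed.

(** Here T(e) = 0 and S(f) = 0, so the inner derivation of -d(e) takes the value d(e) at e. After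
    subtraction d'(f) = d'(f e) and d'(m) = d'(f m e), and both arguments act as zero on the two
    modules. *)
Lemma dimExt1_incomparable : ~~ jge e f -> ~~ jge f e -> dimExt1 S T = 0%N.
Proof.
move=> nef nfe; have [[mS S0 Se] [mT T0 Tf]] := (repS, repT).
have [SM TM] := (proj1 mS, proj1 mT).
apply: dimExt1_eq0 => d der; exists (- d e).
apply/eqP; rewrite -subr_eq0; apply/eqP.
have der' := derivationB mS mT (- d e) der; set d' := d - _ in der' *.
have d'e : d' e = 0.
  by rewrite 3!ffunE Se (T0 _ nfe) mul0mx mulmx1 sub0r opprK subrr.
have vanish m : S m = 0 -> T m = 0 -> d' m = 0.
  exact: (derivation_vanish orthoM mS der').
have d'f : d' f = 0.
  have <- : d' (f ** e) = 0 
    by apply: vanish; rewrite ?SM ?TM ?(S0 _ nef) ?(T0 _ nfe) ?mul0mx ?mulmx0.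
  by rewrite der' d'e Se mulmx0 mulmx1 add0r.
apply/ffunP => m; rewrite [RHS]ffunE.
have <- : d' (f ** m ** e) = 0.
  by apply: vanish; rewrite ?SM ?TM ?(S0 _ nef) ?(T0 _ nfe) ?mul0mx ?mulmx0.
by rewrite !der' d'e d'f Tf Se mulmx0 mul1mx mul0mx mulmx1 add0r addr0.
Qed.

End Vanishing.

(** * Equivariant maps on a finite G-set *)

Section EquivariantMaps.
Variables (k : fieldType) (gT : finGroupType) (O : finType) (act : gT -> O -> O).
Variables (a b : nat).
Implicit Types (L : gT -> 'M[k]_b) (R : gT -> 'M[k]_a) (f : {ffun O -> 'M[k]_(b, a)}).

(** The kernel is the space of maps with f(p o) = L(p) f(o) R(p). In the uses L is a representation
    and R an antirepresentation p to S(p^-1), so these are the equivariant maps into Hom(U,V). *)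
Definition eqv_map L R f : {ffun gT * O -> 'M[k]_(b, a)} :=
  [ffun p => f (act p.1 p.2) - L p.1 *m f p.2 *m R p.1].

Definition eqv_space L R : {vspace {ffun O -> 'M[k]_(b, a)}} := lker (linfun (eqv_map L R)).

Lemma eqv_map_linear L R : linear (eqv_map L R).
Proof.
move=> c u v; apply/ffunP => p; rewrite !ffunE mulmxDr mulmxDl -scalemxAr -scalemxAl.
by rewrite scalerBr opprD addrACA.
Qed.

Lemma eqvP L R f :
  reflect (forall p o, f (act p o) = L p *m f o *m R p) (f \in eqv_space L R).
Proof.
rewrite memv_ker (linfun_apply (@eqv_map_linear L R)); apply: (iffP eqP) => [f0 p o|eqv].
  by have /ffunP/(_ (p, o)) := f0; rewrite !ffunE => /subr0_eq.
by apply/ffunP => -[p o]; rewrite !ffunE /= eqv subrr.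
Qed.

Hypothesis act_inj : forall p, injective (act p).
Hypothesis actM : forall p q o, act (p * q)%g o = act p (act q o).

(** The sum of the translates of the map with value E at x and 0 elsewhere. *)
Definition eqv_avg L R (x : O) (E : 'M[k]_(b, a)) : {ffun O -> 'M[k]_(b, a)} :=
  [ffun y => \sum_(p | act p x == y) L p *m E *m R p].

Lemma eqv_avg_mem L R x E :
  (forall p q, L (p * q)%g = L p *m L q) -> (forall p q, R (p * q)%g = R q *m R p) ->
  eqv_avg L R x E \in eqv_space L R.
Proof.
move=> LM RM; apply/eqvP => q y; rewrite !ffunE (reindex_inj (mulgI q)) /=.
rewrite mulmx_sumr mulmx_suml; apply: eq_big => [p|p _]; last by rewrite LM RM !mulmxA.
by rewrite actM (inj_eq (@act_inj q)).
Qed.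

Lemma mxtrace_tr_delta (A : 'M[k]_(b, a)) i j : \tr (A^T *m delta_mx i j) = A i j.
Proof.
rewrite /mxtrace (bigD1 j) //= big1 => [|l /negbTE lj].
  rewrite addr0 mxE (bigD1 i) //= big1 => [|m /negbTE mi].
    by rewrite addr0 !mxE !eqxx mulr1.
  by rewrite !mxE mi mulr0.
by rewrite mxE big1 // => m _; rewrite !mxE lj andbF mulr0.
Qed.

Lemma dim_eqv_le L R L' R' : #|gT|%:R != 0 :> k ->
  (forall p q, L' (p * q)%g = L' p *m L' q) -> (forall p q, R' (p * q)%g = R' q *m R' p) ->
  (forall p, (L' p)^T *m L p = 1%:M) -> (forall p, R p *m (R' p)^T = 1%:M) ->
  (\dim (eqv_space L R) <= \dim (eqv_space L' R'))%N.
Proof.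
move=> cardG LM RM LL RR.
pose beta f f' : k^o := \sum_y \tr ((f y)^T *m f' y).
apply: (@dim_le_pairing k _ _ _ _ beta) => [v c u w|w c u v|f fE beta0].
- rewrite /beta scaler_sumr -big_split; apply: eq_bigr => y _.
  by rewrite !ffunE mulmxDr mxtraceD -scalemxAr mxtraceZ.
- rewrite /beta scaler_sumr -big_split; apply: eq_bigr => y _.
  by rewrite !ffunE linearD linearZ /= mulmxDl mxtraceD -scalemxAl mxtraceZ.
apply/ffunP => x; apply/matrixP => i j; rewrite ffunE mxE.
apply: (mulfI cardG); rewrite mulr0.
(* Pairing f with the orbit sum of an elementary matrix at x gives |G| times the entry of f(x), by
   equivariance and L^T L' = 1, R' R^T = 1. *)
rewrite -(beta0 _ (eqv_avg_mem x (delta_mx i j) LM RM)) /beta.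
under [RHS]eq_bigr => y _ do rewrite ffunE mulmx_sumr linear_sum.
rewrite [RHS](eq_bigr (fun y => \sum_(p | act p x == y) f x i j)); last first.
  move=> y _; apply: eq_bigr => p /eqP <-; rewrite (eqvP _ _ _ fE).
  have LL' : (L p)^T *m L' p = 1%:M by rewrite -[L' p]trmxK -trmx_mul LL trmx1.
  have RR' : R' p *m (R p)^T = 1%:M by rewrite -[R' p]trmxK -trmx_mul RR trmx1.
  rewrite /= !trmx_mul -!mulmxA (mulmxA (L p)^T) LL' mul1mx mxtrace_mulC -!mulmxA RR'.
  by rewrite mulmx1 mxtrace_tr_delta.
transitivity (\sum_(p : gT) f x i j); first by rewrite sumr_const mulr_natl.
by rewrite (partition_big (fun p => act p x) predT).
Qed.

Lemma dim_eqv L R L' R' : #|gT|%:R != 0 :> k ->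
  (forall p q, L (p * q)%g = L p *m L q) -> (forall p q, R (p * q)%g = R q *m R p) ->
  (forall p q, L' (p * q)%g = L' p *m L' q) -> (forall p q, R' (p * q)%g = R' q *m R' p) ->
  (forall p, (L' p)^T *m L p = 1%:M) -> (forall p, (R' p)^T *m R p = 1%:M) ->
  \dim (eqv_space L R) = \dim (eqv_space L' R').
Proof.
move=> cardG LM RM LM' RM' LL RR.
have tr_inv n (A B : 'M[k]_n) : A^T *m B = 1%:M -> B^T *m A = 1%:M.
  by move=> /(congr1 trmx); rewrite trmx_mul trmxK trmx1.
apply/eqP; rewrite eqn_leq !dim_eqv_le // => p.
- exact: tr_inv.
- exact/mulmx1C/tr_inv/RR.
- exact/mulmx1C/RR.
Qed.

End EquivariantMaps.

(** * Classes of the equivalence relation on e_Y L_{e_X} *)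

Section Classes.
Variables (M : fmonoid) (orthoM : orthogroup M) (eX eY : M).
Hypotheses (idX : idem eX) (idY : idem eY) (ltXY : idem_lt eX eY).

Lemma mulXY : eX ** eY = eX. Proof. by case/and3P: ltXY => /eqP. Qed.
Lemma mulYX : eY ** eX = eX. Proof. by case/and3P: ltXY => _ /eqP. Qed.

Lemma jgeXY : jge eX eY. Proof. by rewrite -mulXY jge_mulr. Qed.

Lemma jgeYX : ~~ jge eY eX.
Proof.
case/and3P: ltXY => _ _; apply: contra => YX; apply/eqP.
by apply: idem_stable; rewrite ?mulXY ?mulYX.
Qed.

Lemma eYLP x : reflect [/\ eY ** x = x, x ** eX = x & jge eX x] (x \in eYL eX eY).
Proof.
apply: (iffP imsetP) => [[z]|[Yx xX Xx]]; rewrite ?(LclassP orthoM) //.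
  case/andP=> /eqP zX Xz ->; rewrite mmulA (idemE idY) -mmulA zX.
  by rewrite (jgeM orthoM) // jgeXY.
by exists x; rewrite ?Yx // (LclassP orthoM) // xX eqxx.
Qed.

Lemma eX_eYL : eX \in eYL eX eY.
Proof. by apply/eYLP; rewrite mulYX (idemE idX) jge_refl. Qed.

Lemma corner_eYL m : jge eX m -> eY ** m ** eX \in eYL eX eY.
Proof.
move=> Xm; apply/eYLP.
by rewrite !mmulA (idemE idY) mulK_idem // !(jgeM orthoM) // jgeXY Xm jge_refl.
Qed.

Lemma maxsubX_eYL h : h \in maxsub eX -> h \in eYL eX eY.
Proof.
case/(maxsubP orthoM _ idX)=> Xh hX jh; apply/eYLP; split=> //.
by rewrite -Xh mmulA mulYX.
Qed.

Lemma maxsubY_jge g : g \in maxsub eY -> jge eX g.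
Proof. by case/(maxsubP orthoM _ idY)=> _ _; apply: jge_trans jgeXY. Qed.

Lemma eYL_act g x h : g \in maxsub eY -> x \in eYL eX eY -> h \in maxsub eX ->
  g ** x ** h \in eYL eX eY.
Proof.
move=> gG /eYLP[Yx xX jx] hG.
have [Yg gY _] := maxsubP orthoM _ idY gG; have [Xh hX jh] := maxsubP orthoM _ idX hG.
apply/eYLP; rewrite !mmulA Yg -!mmulA hX; split=> //.
by rewrite !(jgeM orthoM) // jx jh (maxsubY_jge gG).
Qed.

Lemma eYL_eX x : x \in eYL eX eY -> eX ** x \in maxsub eX.
Proof.
by case/eYLP=> _ xX jx; rewrite -xX mmulA (maxsub_corner orthoM).
Qed.

Lemma mulX_eYL m x : jge eX m -> x \in eYL eX eY -> eX ** m ** x = eX ** m ** eX ** x.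
Proof. by move=> jm /eYLP[_ xX jx]; rewrite -xX !mmulA (cornerM orthoM). Qed.

Lemma mulL_eYL m z : jge eX m -> eY ** m = m -> z \in Lclass eX -> m ** z \in eYL eX eY.
Proof.
move=> jm Ym; rewrite (LclassP orthoM) // => /andP[/eqP zX jz].
by apply/eYLP; rewrite mmulA Ym -mmulA zX (jgeM orthoM) // jm jz.
Qed.

Lemma proper_sigma e : (tideal eX \proper sigma e) = jge eX e && ~~ jge e eX.
Proof. by rewrite (sigmaE orthoM) /proper !tideal_sub. Qed.

Lemma gen_aI m z : jge eX m -> z \in Lclass eX -> gen eX eY (eY ** m ** z) (eY ** m ** eY ** z).
Proof.
move=> jm zL; apply/orP; left; apply/and3P; split.
- by rewrite mulL_eYL ?(jgeM orthoM) ?jgeXY // mmulA (idemE idY).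
- by rewrite mulL_eYL ?(jgeM orthoM) ?jgeXY ?jm // !mmulA (idemE idY).
apply/existsP; exists m; apply/exists_inP; exists z => //.
by rewrite (sigma_sub orthoM) // jm !eqxx.
Qed.

Lemma gen_bI e x y : x \in eYL eX eY -> y \in eYL eX eY -> eX ** x = eX ** y ->
  idem e -> eY ** e = e -> e ** eY = e -> jge eX e -> ~~ jge e eX -> e != eY ->
  e ** x = x -> e ** y = y -> gen eX eY x y.
Proof.
move=> xL yL xy ide Ye eY' Xe neX neY ex ey; apply/orP; right; apply/and4P; split=> //.
  exact/eqP.
apply/exists_inP; exists e.
  by apply/imsetP; exists e; rewrite ?Ye.
by rewrite ide proper_sigma Xe neX neY ex ey !eqxx.
Qed.

Variant gen_spec x y : Prop :=
| GenA m z of jge eX m & z \in Lclass eX & x = eY ** m ** z & y = eY ** m ** eY ** z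
| GenB e of eX ** x = eX ** y & idem e & eY ** e = e & e ** eY = e & jge eX e
    & ~~ jge e eX & e != eY & e ** x = x & e ** y = y.

Lemma genP x y : gen eX eY x y -> [/\ x \in eYL eX eY, y \in eYL eX eY & gen_spec x y].
Proof.
case/orP=> [/and3P[xL yL]|/and4P[xL yL /eqP xy]].
  case/existsP=> m /exists_inP[z zL /and3P[]]; rewrite (sigma_sub orthoM) // => jm.
  by move=> /eqP def_x /eqP def_y; split=> //; apply: GenA jm zL def_x def_y.
case/exists_inP=> e /imsetP[m _ def_e] /and5P[ide].
rewrite proper_sigma => /andP[Xe neX] neY /eqP ex /eqP ey; split=> //.
apply: (@GenB _ _ e) => //; first by rewrite def_e !mmulA (idemE idY).
by rewrite def_e mulK_idem.
Qed.

(** For rule (a) replace m by g m and z by z h; for rule (b) conjugate the idempotent e by g. *)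
Lemma gen_act g x y h : g \in maxsub eY -> h \in maxsub eX -> gen eX eY x y ->
  gen eX eY (g ** x ** h) (g ** y ** h).
Proof.
move=> gG hG /genP[xL yL]; have jg := maxsubY_jge gG.
have [Yg gY _] := maxsubP orthoM _ idY gG; have [Xh hX jh] := maxsubP orthoM _ idX hG.
case=> [m z jm zL -> ->|e xy ide Ye eY' Xe neX neY ex ey].
  have /(gen_aI _) : z ** h \in Lclass eX.
    move: zL; rewrite !(LclassP orthoM) // => /andP[_ jz].
    by rewrite -mmulA hX eqxx (jgeM orthoM) // jz jh.
  move=> /(_ (g ** m)); rewrite (jgeM orthoM) // jg jm => /(_ isT).
  by rewrite !mmulA Yg gY.
have [g'G gg' g'g] := ginvP orthoM idY gG.
have [Yg' g'Y _] := maxsubP orthoM _ idY g'G.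
set g' := ginv eY g in g'G gg' g'g Yg' g'Y.
(* Recovering e from its conjugate shows that the conjugate is neither J-below e_X nor equal to
   e_Y. *)
have conj_g : g' ** (g ** e ** g') ** g = e.
  by rewrite !mmulA g'g Ye -mmulA g'g eY'.
have act_e v : e ** v = v -> eY ** v = v -> g ** e ** g' ** (g ** v ** h) = g ** v ** h.
  by move=> ev Yv; rewrite !mmulA -(mmulA _ g' g) g'g -(mmulA (g ** e)) Yv -(mmulA g) ev.
have [Yx _ _] := eYLP _ xL; have [Yy _ _] := eYLP _ yL.
apply: (@gen_bI (g ** e ** g')); rewrite ?eYL_act ?act_e //.
- by rewrite !mmulA (mulX_eYL jg xL) (mulX_eYL jg yL) -(mmulA _ eX x) -(mmulA _ eX y) xy.
- apply/eqP; rewrite !mmulA -(mmulA _ g' g) g'g -(mmulA _ eY e) Ye.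
  by rewrite mulK_idem.
- by rewrite !mmulA Yg.
- by rewrite -mmulA g'Y.
- by rewrite !(jgeM orthoM) // jg Xe (maxsubY_jge g'G).
- apply: contra neX; apply: jge_trans; rewrite -{1}conj_g.
  exact: jge_trans (jge_mull _ _) (jge_mulr _ _).
apply: contra neY => /eqP eq_eY; move: conj_g; rewrite eq_eY g'Y g'g => ->.
by [].
Qed.

Definition gen_sym := [rel u v | gen eX eY u v || gen eX eY v u].

Lemma equivE x y : equivXY eX eY x y = connect gen_sym x y.
Proof. by []. Qed.

Lemma gen_sym_connect : connect_sym gen_sym.
Proof. by apply: sym_connect_sym => x y; rewrite /= orbC. Qed.

Lemma gen_equiv x y : gen eX eY x y -> equivXY eX eY x y.
Proof. by move=> xy; apply: connect1; rewrite /= xy. Qed.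

Lemma equiv_invariant (A : Type) (f : M -> A) x y :
  (forall u v, gen eX eY u v -> f u = f v) -> equivXY eX eY x y -> f x = f y.
Proof.
move=> inv /connectP[p]; elim: p x => [|z p IH] x /=; first by move=> _ ->.
by case/andP=> /orP[/inv->|/inv<-] /IH; apply.
Qed.

Lemma equiv_act g x y h : g \in maxsub eY -> h \in maxsub eX -> equivXY eX eY x y ->
  equivXY eX eY (g ** x ** h) (g ** y ** h).
Proof.
move=> gG hG /connectP[p]; elim: p x => [|z p IH] x /=.
  by move=> _ ->; apply: connect0.
case/andP=> xz /IH zy /zy; apply: connect_trans; apply: connect1.
by case/orP: xz => /(gen_act gG hG) /= ->; rewrite ?orbT.
Qed.

Lemma equiv_eYL x y : equivXY eX eY x y -> (x \in eYL eX eY) = (y \in eYL eX eY).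
Proof. by apply: (equiv_invariant (f := fun z => z \in eYL eX eY)) => u v /genP[-> ->]. Qed.

(** Rule (b) assumes it, and rule (a) respects it because e_X can be inserted after m in e_X m z.
    Hence x to e_X x has well-defined fibres on classes. *)
Lemma equiv_mulX x y : equivXY eX eY x y -> eX ** x = eX ** y.
Proof.
apply: (equiv_invariant (f := mmul eX)) => u v /genP[_ _ []] // m z jm; rewrite (LclassP orthoM) //.
case/andP=> /eqP zX jz -> ->.
have XmX w : jge eX w -> w ** eX = w -> eX ** (m ** w) = eX ** m ** eX ** w.
  by move=> jw wX; rewrite -wX !mmulA (cornerM orthoM).
rewrite -!(mmulA eY) (mmulA eX eY) (mmulA eX eY) mulXY -[m ** eY ** z]mmulA !XmX //.
- by rewrite mmulA -(mmulA _ eX eY) mulXY.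
- by rewrite (jgeM orthoM) // jgeXY.
- by rewrite -mmulA zX.
Qed.

(** The quotient, encoded by the canonical representatives of the connected components of the
    generating graph. *)
Definition Lcls : Type := {x : M | (x \in eYL eX eY) && (fingraph.root gen_sym x == x)}.
HB.instance Definition _ := Finite.on Lcls.

Lemma root_eYL x : x \in eYL eX eY ->
  (fingraph.root gen_sym x \in eYL eX eY) &&
    (fingraph.root gen_sym (fingraph.root gen_sym x) == fingraph.root gen_sym x).
Proof.
move=> xL; rewrite -(equiv_eYL (connect_root _ x)) xL.
by rewrite (root_root gen_sym_connect) eqxx.
Qed.

Definition cl0 : Lcls := exist _ (fingraph.root gen_sym eX) (root_eYL eX_eYL).
Definition cl x : Lcls := insubd cl0 (fingraph.root gen_sym x).

Lemma val_cl x : x \in eYL eX eY -> val (cl x) = fingraph.root gen_sym x.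
Proof. by move=> xL; rewrite /cl insubdK //; apply: root_eYL. Qed.

Lemma val_eYL (o : Lcls) : val o \in eYL eX eY.
Proof. by case/andP: (valP o). Qed.

Lemma valK_cl (o : Lcls) : cl (val o) = o.
Proof. by apply: val_inj; rewrite val_cl ?val_eYL //; case/andP: (valP o) => _ /eqP. Qed.

Lemma equiv_cl x : x \in eYL eX eY -> equivXY eX eY x (val (cl x)).
Proof. by move=> xL; rewrite val_cl // equivE connect_root. Qed.

Lemma cl_eq x y : x \in eYL eX eY -> y \in eYL eX eY ->
  (cl x == cl y) = equivXY eX eY x y.
Proof. by move=> xL yL; rewrite -val_eqE /= !val_cl // (root_connect gen_sym_connect). Qed.

Lemma cl_equiv x y : equivXY eX eY x y -> cl x = cl y.
Proof. by rewrite equivE -(root_connect gen_sym_connect) /cl => /eqP ->. Qed.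

Local Notation GX := (units_at orthoM idX).
Local Notation GY := (units_at orthoM idY).

Definition cl_act (p : GY * GX) (o : Lcls) : Lcls :=
  cl (val p.1 ** val o ** val (p.2^-1)%g).

Lemma cl_act_cl p x : x \in eYL eX eY ->
  cl_act p (cl x) = cl (val p.1 ** x ** val (p.2^-1)%g).
Proof.
move=> xL; apply/esym/cl_equiv/equiv_act; rewrite ?(valP p.1) ?(valP (p.2^-1)%g) //.
exact: equiv_cl.
Qed.

Lemma cl_actM p q o : cl_act (p * q)%g o = cl_act p (cl_act q o).
Proof.
rewrite cl_act_cl; last by rewrite eYL_act ?val_eYL ?(valP q.1) ?(valP (q.2^-1)%g).
rewrite /cl_act.
have [-> ->] : (p * q)%g.1 = (p.1 * q.1)%g /\ (p * q)%g.2 = (p.2 * q.2)%g by [].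
by rewrite invMg !units_valM !mmulA.
Qed.

Lemma cl_act1 o : cl_act 1%g o = o.
Proof.
rewrite /cl_act.
have [-> ->] : (1 : GY * GX)%g.1 = 1%g /\ (1 : GY * GX)%g.2 = 1%g by [].
rewrite invg1 !units_val1; have [Yo oX _] := eYLP _ (val_eYL o).
by rewrite Yo oX valK_cl.
Qed.

Lemma cl_act_inj p : injective (cl_act p).
Proof.
apply: (can_inj (g := cl_act p^-1%g)) => o.
by rewrite -cl_actM mulVg cl_act1.
Qed.

End Classes.

(** * The dimension of Ext^1 for comparable idempotents *)

Section ExtDimension.
Variables (M : fmonoid) (orthoM : orthogroup M) (eX eY : M).
Hypotheses (idX : idem eX) (idY : idem eY) (ltXY : idem_lt eX eY).
Variable k : fieldType.

Local Notation GX := (units_at orthoM idX).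
Local Notation GY := (units_at orthoM idY).
Local Notation O := (Lcls eX eY).
Local Notation cl := (cl orthoM idX idY ltXY).
Local Notation act := (@cl_act M orthoM eX eY idX idY ltXY).

Section Spaces.
Variables (a b : nat) (S : M -> 'M[k]_a) (T : M -> 'M[k]_b).

Definition class_maps : {vspace {ffun O -> 'M[k]_(b, a)}} :=
  @eqv_space k (GY * GX)%type O act a b (fun p => T (val p.1)) (fun p => S (val (p.2^-1)%g)).

(** Hom over G_Y from U to V, written as equivariant maps on a one-point set so that the duality of
    [dim_eqv] covers it too. *)
Definition intertwiners : {vspace {ffun unit -> 'M[k]_(b, a)}} :=
  @eqv_space k GY unit (fun _ o => o) a b (fun g => T (val g)) (fun g => S (val g^-1%g)).

Lemma class_mapsP (f : {ffun O -> 'M[k]_(b, a)}) :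
  reflect (forall g h x, g \in maxsub eY -> h \in maxsub eX -> x \in eYL eX eY ->
             f (cl (g ** x ** h)) = T g *m f (cl x) *m S h)
          (f \in class_maps).
Proof.
apply: (iffP (eqvP _ _ _ _)) => [eqv g h x gG hG xL|eqv p o].
  pose g' : GY := exist _ g gG; pose h' : GX := exist _ h hG.
  have := eqv (g', h'^-1%g) (cl x).
  by rewrite cl_act_cl //; cbn [fst snd]; rewrite invgK.
by rewrite /cl_act eqv ?val_eYL ?valK_cl ?(valP p.1) ?(valP (p.2^-1)%g).
Qed.

Lemma cl_gen (f : {ffun O -> 'M[k]_(b, a)}) x y : gen eX eY x y -> f (cl x) = f (cl y).
Proof. by move=> /gen_equiv/cl_equiv ->. Qed.

Hypotheses (repS : rep_at eX S) (repT : rep_at eY T).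

Lemma S_eY : S eY = 1%:M.
Proof. by rewrite (rep_at_idem orthoM idX repS) // jgeXY. Qed.

Lemma intertwinersP (f : {ffun unit -> 'M[k]_(b, a)}) :
  reflect (forall g, g \in maxsub eY -> T g *m f tt = f tt *m S g) (f \in intertwiners).
Proof.
have SM := rep_atM repS.
apply: (iffP (eqvP _ _ _ _)) => [eqv g gG|eqv p []].
  have /= eqvg := eqv (exist _ g gG : GY) tt.
  rewrite [in RHS]eqvg -mulmxA -SM.
  have /= -> := units_mulVm (exist _ g gG : GY).
  by rewrite S_eY mulmx1.
by rewrite eqv ?(valP p) // -mulmxA -SM units_mulmV S_eY mulmx1.
Qed.

(** The formula comes from d(m e_X) = T(m) d(e_X) + d(m) and d(m e_X) = d(e_Y m e_X), valid when d
    vanishes on G_Y. *)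
Definition der_of (f : {ffun O -> 'M[k]_(b, a)}) : {ffun M -> 'M[k]_(b, a)} :=
  [ffun m => (if jge eX m then f (cl (eY ** m ** eX)) else 0) - T m *m f (cl eX)].

Lemma der_of_linear : linear der_of.
Proof.
move=> c u v; apply/ffunP => m; rewrite !ffunE mulmxDr -scalemxAr scalerBr opprD.
by case: ifP => _; [rewrite addrACA | rewrite scaler0 !add0r].
Qed.

Lemma T_below m : jge m eX -> T m = 0.
Proof.
move=> mX; apply: (rep_at0 repT); apply: contra (jgeYX idX idY ltXY) => Ym.
exact: jge_trans Ym mX.
Qed.

Lemma T_eYL x : x \in eYL eX eY -> T x = 0.
Proof. by case/(eYLP orthoM idX idY ltXY) => _ <- _; apply: T_below; apply: jge_mulr. Qed.

Lemma S_eYL x : S (eX ** x) = S x.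
Proof. by rewrite (rep_atM repS) (rep_at_id repS) mul1mx. Qed.

Lemma T_corner m : T (eY ** m ** eY) = T m.
Proof. by rewrite !(rep_atM repT) (rep_at_id repT) mul1mx mulmx1. Qed.

(* Rule (b) is only needed when m lies strictly above X; if m is in the J-class of e_X, both products are already equal. *)
Lemma gen_absorb m x : eY ** m = m -> m ** eY = m -> jge eX m -> ~~ jge eY m ->
  x \in eYL eX eY -> cl (m ** x) = cl (m ** eX ** x).
Proof.
move=> Ym mY Xm nYm xL; have [Yx xX Xx] := eYLP orthoM idX idY ltXY _ xL.
have [mX|nmX] := boolP (jge m eX).
  have xX' : jge x eX by rewrite -xX jge_mulr.
  by rewrite (mul_insert orthoM).
apply/cl_equiv/gen_equiv; apply: (@gen_bI _ orthoM _ _ (omega m)).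
- by apply/(eYLP orthoM idX idY ltXY); rewrite mmulA Ym -mmulA xX (jgeM orthoM) // Xm Xx.
- apply/(eYLP orthoM idX idY ltXY).
  by rewrite !mmulA Ym -!mmulA xX !(jgeM orthoM) // Xm Xx jge_refl.
- by rewrite !mmulA (mulX_eYL orthoM idX idY ltXY).
- exact: idem_omega.
- exact: omega_absorb.
- exact: omega_absorbr.
- by rewrite (jge_omega orthoM).
- by apply: contra nmX; apply: jge_trans; rewrite (jge_omega orthoM) jge_refl.
- by apply: contra nYm => /eqP <-; rewrite -(jge_omega orthoM) jge_refl.
- by rewrite mmulA (omega_mulK orthoM).
- by rewrite !mmulA (omega_mulK orthoM).
Qed.

(** The cocycle identity for [der_of f]. Rule (a) replaces m by m' = e_Y m e_Y acting on x = e_Y n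
    e_X, and the cases m' in G_Y and T(m') = 0 are treated apart. *)
Lemma class_maps_mul (f : {ffun O -> 'M[k]_(b, a)}) m n : f \in class_maps -> jge eX m -> jge eX n ->
  f (cl (eY ** (m ** n) ** eX)) =
  T m *m (f (cl (eY ** n ** eX)) - f (cl eX) *m S n) + f (cl (eY ** m ** eX)) *m S n.
Proof.
move=> /class_mapsP eqv Xm Xn.
have nL : n ** eX \in Lclass eX.
  by rewrite (LclassP orthoM) // mulK_idem // eqxx (jgeM orthoM) // Xn jge_refl.
have XL : eX \in Lclass eX by rewrite (LclassP orthoM) // (idemE idX) eqxx jge_refl.
have -> : f (cl (eY ** (m ** n) ** eX)) = f (cl (eY ** m ** eY ** (eY ** n ** eX))).
  rewrite !mmulA mulK_idem // -(mmulA _ n eX) -(mmulA (_ ** eY) n eX).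
  exact/cl_gen/gen_aI.
have -> : f (cl (eY ** m ** eX)) = f (cl (eY ** m ** eY ** eX)).
  exact/cl_gen/gen_aI.
have xL := corner_eYL orthoM idX idY ltXY Xn.
have Sx : S (eY ** n ** eX) = S n.
  by rewrite !(rep_atM repS) S_eY (rep_at_id repS) mul1mx mulmx1.
move: (eY ** n ** eX) xL Sx => x xL Sx.
have Xm' : jge eX (eY ** m ** eY) by rewrite !(jgeM orthoM) // Xm (jgeXY ltXY).
have [Ym' m'Y] : eY ** (eY ** m ** eY) = eY ** m ** eY /\ eY ** m ** eY ** eY = eY ** m ** eY.
  by rewrite !mmulA (idemE idY) mulK_idem.
have m'G : jge eY (eY ** m ** eY) -> eY ** m ** eY \in maxsub eY.
  by move=> Ym; apply/(maxsubP orthoM).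
rewrite -(T_corner m); move: (eY ** m ** eY) Xm' Ym' m'Y m'G => m' Xm' Ym' m'Y m'G.
have [Ym|nYm] := boolP (jge eY m').
  have [_ xX _] := eYLP orthoM idX idY ltXY _ xL.
  have := eqv m' eX x (m'G Ym) (maxsub_id orthoM idX) xL; rewrite -mmulA xX => ->.
  have := eqv m' eX eX (m'G Ym) (maxsub_id orthoM idX) (eX_eYL orthoM idX idY ltXY).
  rewrite -mmulA (idemE idX) => ->.
  by rewrite (rep_at_id repS) !mulmx1 mulmxBr mulmxA subrK.
(* Outside G_Y, the class of m' x is that of (m' e_X)(e_X x), a right translate by an element of
   G_X, so equivariance applies. *)
rewrite (rep_at0 repT nYm) mul0mx add0r gen_absorb //.
have hG := eYL_eX orthoM idX idY ltXY xL.
have m'L : m' ** eX \in eYL eX eY by rewrite (mulL_eYL orthoM idX idY ltXY).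
have := eqv eY (eX ** x) (m' ** eX) (maxsub_id orthoM idY) hG m'L.
rewrite !mmulA Ym' mulK_idem // => ->.
by rewrite (rep_at_id repT) mul1mx S_eYL Sx.
Qed.

Lemma der_of_derivation (f : {ffun O -> 'M[k]_(b, a)}) : f \in class_maps -> derivation S T (der_of f).
Proof.
move=> fE m n; rewrite !ffunE (jgeM orthoM) // (rep_atM repT).
have [Xm|nXm] := boolP (jge eX m); last first.
  have nYm : ~~ jge eY m by apply: contra nXm; apply: jge_trans (jgeXY ltXY).
  by rewrite (rep_at0 repT nYm) !mul0mx !subr0 mul0mx addr0.
have [Xn|nXn] /= := boolP (jge eX n); last first.
  have nYn : ~~ jge eY n by apply: contra nXn; apply: jge_trans (jgeXY ltXY).
  by rewrite (rep_at0 repT nYn) (rep_at0 repS nXn) !mulmx0 mul0mx subr0 mulmx0 addr0.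
rewrite class_maps_mul // !mulmxBr mulmxBl !mulmxA.
set A := _ *m f _; set B := _ *m S n; set C := _ *m S n; set D := _ *m f _.
by rewrite [D - C + B]addrAC [RHS]addrACA [- A - C]addrC [RHS]addrA.
Qed.

Lemma der_of_units (f : {ffun O -> 'M[k]_(b, a)}) g : f \in class_maps ->
  g \in maxsub eY -> der_of f g = 0.
Proof.
move=> /class_mapsP eqv gG; have [Yg _ _] := maxsubP orthoM _ idY gG.
rewrite ffunE (maxsubY_jge orthoM idY ltXY gG) Yg.
have := eqv g eX eX gG (maxsub_id orthoM idX) (eX_eYL orthoM idX idY ltXY).
by rewrite mulK_idem // => ->; rewrite (rep_at_id repS) mulmx1 subrr.
Qed.

(** T vanishes on e_Y L_{e_X}, so [der_of f] takes there the values of f. *)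
Lemma der_of_inj (f : {ffun O -> 'M[k]_(b, a)}) : der_of f = 0 -> f = 0.
Proof.
move=> /ffunP f0; apply/ffunP => o; rewrite [RHS]ffunE.
have oL := val_eYL o; have [Yo oX Xo] := eYLP orthoM idX idY ltXY _ oL.
by have := f0 (val o); rewrite !ffunE Xo Yo oX valK_cl T_eYL // mul0mx subr0.
Qed.

Section Normalised.
Variable d : {ffun M -> 'M[k]_(b, a)}.
Hypotheses (der : derivation S T d) (dG : forall g, g \in maxsub eY -> d g = 0).

Lemma der_mulY m : d (eY ** m) = d m.
Proof. by rewrite der (dG (maxsub_id orthoM idY)) mul0mx addr0 (rep_at_id repT) mul1mx. Qed.

(** For rule (a), expand d(m z) and d(m e_Y z), using S(e_Y) = 1. For rule (b), T(e) = 0 gives d(w)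
    = d(e) S(w) whenever e w = w, and S(w) depends only on e_X w. *)
Lemma der_equiv x y : equivXY eX eY x y -> d x = d y.
Proof.
apply: equiv_invariant => u v /(genP orthoM idY)[_ _ []] => [m z _ _ -> ->|e].
  rewrite -!mmulA !der_mulY (der m z) (der m (eY ** z)) der_mulY (rep_atM repS) S_eY.
  by rewrite mul1mx.
move=> uv ide Ye eY' _ _ neY eu ev.
have Te : T e = 0.
  apply: (rep_at0 repT); apply: contra neY => jYe; apply/eqP.
  exact: idem_stable.
have de w : e ** w = w -> d w = d e *m S w.
  by move=> ew; rewrite -{1}ew der Te mul0mx add0r.
by rewrite (de u) // (de v) // -(S_eYL u) uv S_eYL.
Qed.

Lemma der_cl x : x \in eYL eX eY -> d (val (cl x)) = d x.
Proof. by move=> xL; apply/esym/der_equiv/equiv_cl. Qed.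

Lemma der_of_surj : exists2 f, f \in class_maps & d = der_of f.
Proof.
pose f : {ffun O -> 'M[k]_(b, a)} := [ffun o => d (val o)].
exists f.
  apply/class_mapsP => g h x gG hG xL.
  rewrite !ffunE !der_cl ?(eYL_act orthoM idX idY ltXY) //.
  by rewrite (der _ h) (der g x) (dG gG) (rep_atM repT) (T_eYL xL) mulmx0 !mul0mx addr0 add0r.
apply/ffunP => m; rewrite !ffunE (der_cl (eX_eYL orthoM idX idY ltXY)).
case: ifP => Xm.
  rewrite (der_cl (corner_eYL orthoM idX idY ltXY Xm)) -mmulA der_mulY der (rep_at_id repS) mulmx1.
  by rewrite addrC addKr.
have nYm : ~~ jge eY m.
  by apply/negP => Ym; rewrite (jge_trans (jgeXY ltXY) Ym) in Xm.
rewrite (rep_at0 repT nYm) mul0mx subr0.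
have [mS _ _] := repS; apply: (derivation_vanish orthoM mS der).
  by rewrite (rep_at0 repS) ?Xm.
exact: rep_at0 repT _ nYm.
Qed.

End Normalised.

Lemma inner_map_inj X : inner_map S T X = 0 -> X = 0.
Proof.
move=> /ffunP/(_ eX); rewrite !ffunE (rep_at_id repS) (T_below (jge_refl _)).
by rewrite mul0mx mulmx1 sub0r => /eqP; rewrite oppr_eq0 => /eqP.
Qed.

Definition inner_of (u : {ffun unit -> 'M[k]_(b, a)}) := inner_map S T (u tt).

Lemma inner_of_linear : linear inner_of.
Proof. by move=> c u v; rewrite /inner_of !ffunE inner_map_linear. Qed.

Hypothesis cardY : #|maxsub eY|%:R != 0 :> k.

(** Averaging over G_Y shows that the derivations Z are U + B, with B the inner ones and U those
    vanishing on G_Y; U and B meet in the image V of the intertwiners. Hence dim Z - dim B = dim U -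
    dim V. *)
Lemma dimExt1_classes : dimExt1 S T = (\dim class_maps - \dim intertwiners)%N.
Proof.
have [[mS _ Se] [mT _ Te]] := (repS, repT).
set Z := lker (linfun (der_map S T)); set B := limg (linfun (inner_map S T)).
set U := (linfun der_of @: class_maps)%VS; set V := (linfun inner_of @: intertwiners)%VS.
have dimU : \dim U = \dim class_maps.
  apply: limg_dim_eq; apply/eqP; rewrite -subv0; apply/subvP => f.
  rewrite memv_cap memv_ker memv0 (linfun_apply der_of_linear).
  by case/andP=> _ /eqP/der_of_inj ->.
have dimV : \dim V = \dim intertwiners.
  apply: limg_dim_eq; apply/eqP; rewrite -subv0; apply/subvP => f.
  rewrite memv_cap memv_ker memv0 (linfun_apply inner_of_linear).
  case/andP=> _ /eqP/inner_map_inj f0; apply/eqP/ffunP => -[].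
  by rewrite f0 ffunE.
have UP d : reflect (derivation S T d /\ forall g, g \in maxsub eY -> d g = 0) (d \in U).
  apply: (iffP memv_imgP) => [[f fE ->]|[der dG]]; rewrite ?(linfun_apply der_of_linear).
    by split=> [|g gG]; [apply: der_of_derivation | apply: der_of_units].
  have [f fE ->] := der_of_surj der dG; exists f => //.
  by rewrite (linfun_apply der_of_linear).
have UBZ : (U + B)%VS = Z.
  apply/eqP; rewrite eqEsubv; apply/andP; split.
    rewrite subv_add; apply/andP; split; apply/subvP => d.
      by case/UP=> der _; apply/der_mapP.
    by case/inner_mapP=> X ->; apply/der_mapP/inner_derivation.
  apply/subvP => d /der_mapP der.
  have [X dX] := derivation_inner_on_units orthoM mS mT idY cardY S_eY Te der.
  rewrite -(subrK (inner_map S T X) d); apply: memv_add; last by apply/inner_mapP; exists X.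
  apply/UP; split; first exact: derivationB.
  by move=> g gG; rewrite 2!ffunE dX // subrr.
have UBV : (U :&: B)%VS = V.
  apply/eqP; rewrite eqEsubv; apply/andP; split; apply/subvP => d.
    rewrite memv_cap => /andP[/UP[_ dG] /inner_mapP[X def_d]].
    apply/memv_imgP; exists [ffun=> X]; last first.
      by rewrite (linfun_apply inner_of_linear) /inner_of ffunE.
    apply/intertwinersP => g /dG; rewrite def_d !ffunE => /eqP.
    by rewrite subr_eq0 => /eqP.
  case/memv_imgP=> u /intertwinersP uT ->; rewrite (linfun_apply inner_of_linear).
  rewrite memv_cap; apply/andP; split; last by apply/inner_mapP; exists (u tt).
  apply/UP; split; first exact: inner_derivation.
  by move=> g gG; rewrite ffunE uT // subrr.
have := dimv_sum_cap U B; rewrite UBZ UBV dimU dimV /dimExt1 -/Z -/B; lia.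
Qed.

End Spaces.

Hypotheses (cardX : #|maxsub eX|%:R != 0 :> k) (cardY : #|maxsub eY|%:R != 0 :> k).

Section Dual.
Variables (a b : nat) (S S' : M -> 'M[k]_a) (T T' : M -> 'M[k]_b).
Hypotheses (repS : rep_at eX S) (repT : rep_at eY T).
Hypotheses (repS' : rep_at eX S') (repT' : rep_at eY T').
Hypotheses (dualS : contragredient eX S S') (dualT : contragredient eY T T').

Lemma dim_class_maps_dual : \dim (class_maps S T) = \dim (class_maps S' T').
Proof.
have [SM TM] := (rep_atM repS, rep_atM repT).
have [SM' TM'] := (rep_atM repS', rep_atM repT').
apply: dim_eqv.
- exact: cl_act_inj.
- exact: cl_actM.
- by rewrite card_prod !card_units_at natrM mulf_neq0.
- by move=> p q; rewrite -TM.
- move=> p q; rewrite -SM -units_valM -invMg //.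
- by move=> p q; rewrite -TM'.
- move=> p q; rewrite -SM' -units_valM -invMg //.
- by move=> p; apply: dualT; case/(maxsubP orthoM _ idY): (valP p.1).
- by move=> p; apply: dualS; case/(maxsubP orthoM _ idX): (valP (p.2^-1)%g).
Qed.

Lemma dim_intertwiners_dual : \dim (intertwiners S T) = \dim (intertwiners S' T').
Proof.
have [SM TM] := (rep_atM repS, rep_atM repT).
have [SM' TM'] := (rep_atM repS', rep_atM repT').
apply: dim_eqv => //.
- by move=> _ [] [].
- by rewrite card_units_at.
- by move=> p q; rewrite -TM.
- by move=> p q; rewrite -SM -units_valM -invMg.
- by move=> p q; rewrite -TM'.
- by move=> p q; rewrite -SM' -units_valM -invMg.
- by move=> p; apply: dualT; case/(maxsubP orthoM _ idY): (valP p).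
- move=> p; apply: dualS; exact: maxsubY_jge (valP (p^-1)%g).
Qed.

Lemma dimExt1_dual : dimExt1 S T = dimExt1 S' T'.
Proof. by rewrite !dimExt1_classes // dim_class_maps_dual dim_intertwiners_dual. Qed.

End Dual.
End ExtDimension.

(** * The opposite monoid *)

Section Opposite.
Variable M : fmonoid.

Lemma jge_op (e m : M) : @jge (opmon M) e m = jge e m.
Proof.
by apply/jgeP/jgeP => -[a [b def_e]]; exists b, a; rewrite def_e /= mmulA.
Qed.

Lemma tideal_op (e : M) : @tideal (opmon M) e = tideal e.
Proof. by apply/setP => x; apply: (jge_op x e). Qed.

Lemma orthogroup_op : orthogroup M -> orthogroup (opmon M).
Proof.
case=> rectM regM; split.
  move=> e f g ide idf idg; rewrite !tideal_op => fe ge.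
  exact: rectM ide idg idf ge fe.
by move=> m; have [n def_m] := regM m; exists n; rewrite /= mmulA.
Qed.

Lemma maxsub_op (e : M) : @maxsub (opmon M) e = maxsub e.
Proof.
have corner_op : @corner (opmon M) e = corner e.
  by apply/setP => x; apply/imsetP/imsetP => -[m _ ->]; exists m; rewrite //= mmulA.
apply/setP => g; rewrite !inE corner_op; congr (_ && _).
by apply/existsP/existsP => -[h /and3P[hc gh hg]]; exists h; apply/and3P.
Qed.

Section Transpose.
Variable k : fieldType.

Lemma rep_at_op (e : M) n (rho : M -> 'M[k]_n) : rep_at e rho ->
  @rep_at k (opmon M) e n (fun m => (rho m)^T).
Proof.
move=> [[rhoM rho1] rho0 rhoe]; split; first split=> [x y|].
- by rewrite /= rhoM trmx_mul.
- by rewrite /= rho1 trmx1.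
- by move=> m; rewrite jge_op => /rho0 ->; rewrite trmx0.
- by rewrite rhoe trmx1.
Qed.

Variables (a b : nat) (S : M -> 'M[k]_a) (T : M -> 'M[k]_b).
Let S' : opmon M -> 'M[k]_a := fun m => (S m)^T.
Let T' : opmon M -> 'M[k]_b := fun m => (T m)^T.

Definition trmx_ffun m n (d : {ffun M -> 'M[k]_(m, n)}) : {ffun opmon M -> 'M[k]_(n, m)} :=
  [ffun x => (d x)^T].

Lemma trmx_ffun_linear m n : linear (@trmx_ffun m n).
Proof. by move=> c u v; apply/ffunP => x; rewrite !ffunE linearP. Qed.

Lemma dimExt1_op : dimExt1 S T = @dimExt1 k (opmon M) b a T' S'.
Proof.
have trE := linfun_apply (@trmx_ffun_linear b a).
have dim_tr (U : {vspace {ffun M -> 'M[k]_(b, a)}}) :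
    \dim (linfun (@trmx_ffun b a) @: U) = \dim U.
  apply: limg_dim_eq; apply/eqP; rewrite -subv0; apply/subvP => d.
  rewrite memv_cap memv_ker memv0 trE => /andP[_ /eqP/ffunP d0].
  apply/eqP/ffunP => x; have := d0 x; rewrite !ffunE => /(congr1 trmx).
  by rewrite trmxK trmx0.
have dim_eq U U' : (linfun (@trmx_ffun b a) @: U)%VS = U' -> \dim U = \dim U'.
  by move=> <-.
rewrite /dimExt1; congr (_ - _)%N; apply: dim_eq.
  apply/eqP; rewrite eqEsubv; apply/andP; split; apply/subvP => d.
    case/memv_imgP=> d' /der_mapP der ->; rewrite trE; apply/der_mapP => x y.
    by rewrite !ffunE /= der raddfD /= !trmx_mul addrC.
  move/der_mapP=> der; apply/memv_imgP; exists [ffun x => (d x)^T].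
    apply/der_mapP => x y; have := der y x; rewrite !ffunE /= => ->.
    by rewrite raddfD /= !trmx_mul !trmxK addrC.
  by rewrite trE; apply/ffunP => x; rewrite !ffunE trmxK.
apply/eqP; rewrite eqEsubv; apply/andP; split; apply/subvP => d.
  (* Transposing T X - X S exchanges the two terms, whence the sign in -X^T. *)
  case/memv_imgP=> d' /inner_mapP[X ->] ->; rewrite trE; apply/inner_mapP; exists (- X^T).
  apply/ffunP => x; rewrite !ffunE raddfB /= !trmx_mul mulmxN mulNmx opprK.
  by rewrite addrC.
case/inner_mapP=> X ->; apply/memv_imgP; exists (inner_map S T (- X^T)).
  by apply/inner_mapP; exists (- X^T).
rewrite trE; apply/ffunP => x; rewrite !ffunE raddfB /= !trmx_mul raddfN /= trmxK.
by rewrite mulmxN mulNmx opprK addrC.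
Qed.

End Transpose.
End Opposite.

(** * Arranging comparable idempotents *)

Section BelowIdempotent.
Variables (M : fmonoid) (orthoM : orthogroup M).

(** The witness (f e f)^omega is fixed by f on both sides, and it stays in the J-class of e because
    the elements above e are closed under products. *)
Lemma exists_idem_below (e f : M) : idem e -> idem f -> jge e f -> ~~ jge f e ->
  exists e', [/\ idem e', tideal e = tideal e' & idem_lt e' f].
Proof.
move=> ide idf ef nfe; exists (omega (f ** e ** f)).
have ee' : jge e (omega (f ** e ** f)).
  by rewrite (jge_omega orthoM) !(jgeM orthoM) // ef jge_refl.
have e'e : jge (omega (f ** e ** f)) e.
  have : jge (omega (f ** e ** f)) (f ** e ** f) by rewrite -(jge_omega orthoM) jge_refl.
  by move/jge_trans; apply; apply: jge_trans (jge_mull _ _) (jge_mulr _ _).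
split; [exact: idem_omega | exact/tideal_eqP |].
rewrite /idem_lt omega_absorbr ?mulK_idem // omega_absorb ?mmulA ?(idemE idf) // !eqxx.
by apply: contra nfe => /eqP <-.
Qed.

End BelowIdempotent.

Lemma rep_at_eq (M : fmonoid) (k : fieldType) (e : M) n (rho rho' : M -> 'M[k]_n) : rho =1 rho' -> rep_at e rho ->
  rep_at e rho'.
Proof.
move=> eq_rho [[rhoM rho1] rho0 rhoe]; split; first split=> [x y|]; rewrite -?eq_rho //.
by move=> m /rho0 <-.
Qed.

Section OppositeArrows.
Variables (M : fmonoid) (orthoM : orthogroup M) (k : fieldType).

(** Contragredient followed by transposition leaves only g to g^-1, which is the passage to the
    opposite group. *)
Lemma lift_oprep (e : M) n (rho : M -> 'M[k]_n) : idem e -> is_grep e rho ->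
  (fun m => (rep_dual e (Defs.lift e rho) m)^T) =1 @Defs.lift k (opmon M) e n (oprep e rho).
Proof.
move=> ide grep m; have rep := lift_rep_at orthoM ide grep.
have -> : @Defs.lift k (opmon M) e n (oprep e rho) m =
    if jge e m then rho (ginv e (e ** m ** e)) else 0.
  by rewrite /Defs.lift (sigma_sub (orthogroup_op orthoM)) // jge_op /oprep /= mmulA.
rewrite /rep_dual; case: ifP => em; last by rewrite trmx0.
have gG := maxsub_corner orthoM ide em; have [g'G _ _] := ginvP orthoM ide gG.
rewrite trmxK -(lift_maxsub orthoM rho ide g'G).
rewrite (rep_at_ginv orthoM ide rep) // !(rep_atM rep) (rep_at_id rep).
by rewrite mul1mx mulmx1.
Qed.

Hypothesis chark : forall e : M, idem e -> [pchar k]^'.-nat #|maxsub e|.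

Lemma arrows_op (e f : M) (ide : idem e) (idf : idem f) nU (rU : M -> 'M[k]_nU)
    nV (rV : M -> 'M[k]_nV) : is_grep e rU -> is_grep f rV ->
  tideal f \proper tideal e ->
  arrows e rU f rV = @arrows k (opmon M) f _ (oprep f rV) e _ (oprep e rU).
Proof.
move=> grepU grepV; rewrite /proper !tideal_sub => /andP[fe nef].
have orthoN := orthogroup_op orthoM.
have repU := lift_rep_at orthoM ide grepU; have repV := lift_rep_at orthoM idf grepV.
(* The invariance of Ext^1 under contragredients is proved for comparable idempotents, so f is
   replaced by some f' < e in its J-class. *)
have [f' [idf' ff' ltf']] : exists f' : opmon M, [/\ idem f',
    @tideal (opmon M) f = tideal f' & idem_lt f' (e : opmon M)].
  by apply: (exists_idem_below orthoN) => //; rewrite jge_op.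
rewrite /arrows dimExt1_op.
have dualN (g : M) n (rho : M -> 'M[k]_n) : idem g -> is_grep g rho ->
    let rho1 := fun m : opmon M => (Defs.lift g rho m)^T in
    let rho2 := @Defs.lift k (opmon M) g n (oprep g rho) in
    [/\ rep_at (g : opmon M) rho1, rep_at (g : opmon M) rho2
      & contragredient (g : opmon M) rho1 rho2].
  move=> idg grep rho1 rho2; have rep := lift_rep_at orthoM idg grep.
  have eq_rho2 := lift_oprep idg grep.
  split; first exact: rep_at_op.
    apply: (@rep_at_eq (opmon M) k g _ _ _ eq_rho2).
    by apply: rep_at_op; apply: rep_dual_rep_at.
  move=> m; rewrite jge_op => gm; rewrite /rho1 /rho2 -eq_rho2 trmxK.
  by rewrite /rep_dual gm -trmx_mul mulmxV ?trmx1 // (rep_at_unit orthoM idg rep).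
have [repV1 repV2 dualV] := dualN f _ rV idf grepV.
have [repU1 repU2 dualU] := dualN e _ rU ide grepU.
have cardN (g : opmon M) : @idem M g -> #|@maxsub (opmon M) g|%:R != 0 :> k.
  by move=> idg; rewrite maxsub_op natf_neq0_pchar chark.
apply: (dimExt1_dual (eX := f') (eY := e) orthoN) => //.
- exact: cardN.
- exact: cardN.
- exact: (rep_at_conj orthoN (e := f)).
- exact: (rep_at_conj orthoN (e := f)).
move=> m f'm; apply: dualV; apply: jge_trans f'm.
by case/tideal_eqP: ff'.
Qed.

End OppositeArrows.

(** * Endomorphisms of the tensor module *)

Lemma ginvK (M : fmonoid) (orthoM : orthogroup M) (e g : M) : idem e -> g \in maxsub e ->
  ginv e (ginv e g) = g.
Proof.
move=> ide gG; pose g' : units_at orthoM ide := exist _ g gG.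
by have := congr1 val (invgK g').
Qed.

Section AbsolutelyIrreducible.
Variables (k : fieldType) (M : fmonoid).

(** The matrices rho(m) span the full matrix algebra, so a linear map is determined by its values on
    them. *)
Lemma abs_irr_span n (rho : M -> 'M[k]_n) (W : lmodType k) (F : 'M[k]_n -> W) :
  abs_irr rho -> linear F -> (forall m, F (rho m) = 0) -> forall P, F P = 0.
Proof.
move=> [_ full] linF F0 P; have /submxP[u def_P] := submx_full (mxvec P) full.
pose F' : {linear 'M[k]_n -> W} := HB.pack F (GRing.isLinear.Build k _ _ *:%R F linF).
rewrite -[P]mxvecK def_P mulmx_sum_row linear_sum -[F _]/(F' _) linear_sum big1 // => i _.
by rewrite linearZ linearZ /= rowK mxvecK F0 scaler0.
Qed.

Lemma splits_abs_irr (orthoM : orthogroup M) (e : M) n (rho : M -> 'M[k]_n) :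
  splits k M -> idem e -> is_grep e rho -> irr_on (maxsub e) rho ->
  abs_irr (Defs.lift e rho).
Proof.
move=> splitk ide grep [n0 irr]; have [mrep _ _] := lift_rep_at orthoM ide grep.
apply: splitk mrep _; split=> // W stableW; apply: irr => g gG.
by rewrite -(lift_maxsub orthoM rho ide gG) stableW ?inE.
Qed.

Lemma tensmx_linearl m n p q (B : 'M[k]_(p, q)) :
  linear (fun A : 'M[k]_(m, n) => tensmx A B).
Proof.
move=> c A A'; apply/matrixP => i j.
case: (mxtens_indexP i) => i0 i1; case: (mxtens_indexP j) => j0 j1.
by rewrite !mxE mulrDl mulrA.
Qed.

Lemma tensmx_linearr m n p q (A : 'M[k]_(m, n)) :
  linear (fun B : 'M[k]_(p, q) => tensmx A B).
Proof.
move=> c B B'; apply/matrixP => i j.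
case: (mxtens_indexP i) => i0 i1; case: (mxtens_indexP j) => j0 j1.
by rewrite !mxE mulrDr mulrCA.
Qed.

Lemma tensmx_delta m n (i i' : 'I_m) (j j' : 'I_n) :
  tensmx (delta_mx i i') (delta_mx j j') =
  delta_mx (mxtens_index (i, j)) (mxtens_index (i', j')) :> 'M[k]_(m * n).
Proof.
apply/matrixP => s t; case: (mxtens_indexP s) => s0 s1; case: (mxtens_indexP t) => t0 t1.
rewrite tensmxE !mxE !(inj_eq (can_inj (@mxtens_indexK _ _))) !xpair_eqE.
by do !case: eqP => _; rewrite /= ?mulr1 ?mulr0.
Qed.

Lemma cent_delta_scalar n (A : 'M[k]_n) :
  (forall i j, A *m delta_mx i j = delta_mx i j *m A) -> forall i : 'I_n, A = (A i i)%:M.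
Proof.
move=> comm t; apply/matrixP => i s; have /matrixP/(_ i t) := comm s t.
rewrite !mxE (bigD1 s) //= big1 => [|l /negbTE ls]; last by rewrite mxE ls mulr0.
rewrite (bigD1 t) //= big1 => [|l /negbTE lt]; last by rewrite mxE lt andbF mul0r.
by rewrite !mxE !eqxx /= andbT mulr1 !addr0 mulr_natl.
Qed.

End AbsolutelyIrreducible.

Section TensorEnd.
Variables (M : fmonoid) (orthoM : orthogroup M) (eX eY : M).
Hypotheses (idX : idem eX) (idY : idem eY).
Variables (k : fieldType) (nU nV : nat) (rU : M -> 'M[k]_nU) (rV : M -> 'M[k]_nV).
Hypotheses (grepU : is_grep eX rU) (grepV : is_grep eY rV).
Local Notation S := (Defs.lift eX rU).
Local Notation T := (Defs.lift eY rV).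
Hypotheses (absS : abs_irr S) (absT : abs_irr T).
Local Notation W := (tens_dual eX rV rU).

Lemma end_map_linear d (rW : M * M -> 'M[k]_d) : linear (end_map eX eY rW).
Proof.
move=> c A B; apply/ffunP => p; rewrite !ffunE; case: ifP => _; last by rewrite scaler0 addr0.
by rewrite mulmxDl mulmxDr -scalemxAl -scalemxAr opprD addrACA scalerBr.
Qed.

Lemma tens_dual_comm A : A \in lker (linfun (end_map eX eY W)) ->
  forall m n, A *m tensmx (T m) (S n)^T = tensmx (T m) (S n)^T *m A.
Proof.
rewrite memv_ker (linfun_apply (@end_map_linear _ W)) => /eqP/ffunP comm m n.
have repS := lift_rep_at orthoM idX grepU; have repT := lift_rep_at orthoM idY grepV.
have [Ym|nYm] := boolP (jge eY m); last first.
  by rewrite (rep_at0 repT nYm) tens0mx mul0mx mulmx0.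
have [Xn|nXn] := boolP (jge eX n); last first.
  by rewrite (rep_at0 repS nXn) trmx0 tensmx0 mul0mx mulmx0.
have gG := maxsub_corner orthoM idY Ym; have hG := maxsub_corner orthoM idX Xn.
have [h'G _ _] := ginvP orthoM idX hG.
have := comm (eY ** m ** eY, ginv eX (eX ** n ** eX)).
rewrite !ffunE /in_GYX /= gG h'G /= /tens_dual /= (ginvK orthoM idX hG).
rewrite -(lift_maxsub orthoM rU idX hG) -(lift_maxsub orthoM rV idY gG).
rewrite !(rep_atM repS) !(rep_atM repT) (rep_at_id repS) (rep_at_id repT).
by rewrite !mul1mx !mulmx1 => /eqP; rewrite subr_eq0 => /eqP.
Qed.

(** Schur's lemma: spanning in each tensor factor in turn makes A commute with all products of
    matrix units, which are the matrix units of the tensor product. *)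
Lemma tens_dual_scalar A : A \in lker (linfun (end_map eX eY W)) ->
  forall i, A = (A i i)%:M.
Proof.
move=> /tens_dual_comm comm; apply: cent_delta_scalar => s t.
case: (mxtens_indexP s) => s0 s1; case: (mxtens_indexP t) => t0 t1; rewrite -tensmx_delta.
apply/eqP; rewrite -subr_eq0; apply/eqP.
have linM (B : 'M[k]_(nV * nU)) : linear (fun D => A *m D - D *m A).
  move=> c D D'; rewrite mulmxDl mulmxDr -scalemxAl -scalemxAr opprD addrACA.
  by rewrite scalerBr.
pose F B D := A *m tensmx B D^T - tensmx B D^T *m A.
rewrite -[delta_mx s1 t1]trmxK -/(F _ _).
apply: (abs_irr_span absT (F := fun B => F B _)) => [c B B'|m].
  by rewrite /F tensmx_linearl linM.
apply: (abs_irr_span absS (F := F (T m))) => [c B B'|n].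
  by rewrite /F linearP /= tensmx_linearr linM.
by rewrite /F comm subrr.
Qed.

Lemma dimEnd_tens_dual : dimEndXY eX eY W = 1%N.
Proof.
case: absS absT => nU0 _ [nV0 _].
pose i := mxtens_index (Ordinal nV0, Ordinal nU0).
rewrite /dimEndXY.
have -> : lker (linfun (end_map eX eY W)) = <[1%:M]>%VS.
  apply/eqP; rewrite eqEsubv; apply/andP; split; apply/subvP => A.
    by move/tens_dual_scalar/(_ i) => ->; apply/vlineP; exists (A i i); rewrite scalemx1.
  case/vlineP=> c ->; rewrite memv_ker (linfun_apply (@end_map_linear _ W)).
  apply/eqP/ffunP => p; rewrite !ffunE; case: ifP => // _.
  by rewrite scalemx1 scalar_mxC subrr.
rewrite dim_vline; case: eqP => // /matrixP/(_ i i)/eqP.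
by rewrite !mxE eqxx oner_eq0.
Qed.

End TensorEnd.

(** * Homomorphisms into V_{X,Y} *)

Section HomDimension.
Variables (M : fmonoid) (orthoM : orthogroup M) (eX eY : M).
Hypotheses (idX : idem eX) (idY : idem eY) (ltXY : idem_lt eX eY).
Variable k : fieldType.

Local Notation GX := (units_at orthoM idX).
Local Notation GY := (units_at orthoM idY).
Local Notation O := (Lcls eX eY).
Local Notation cl := (cl orthoM idX idY ltXY).
Local Notation act := (@cl_act M orthoM eX eY idX idY ltXY).
Local Notation VXY := (VXY k eX eY).
Local Notation cls := (cls k eX eY).

Lemma cls_cl x (o : O) : x \in eYL eX eY -> cls x (val o) = (cl x == o)%:R.
Proof.
by move=> xL; rewrite ffunE val_eYL -{2}[o](valK_cl orthoM idX idY ltXY) cl_eq ?val_eYL.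
Qed.

(** A linear condition on V_{X,Y} need only be tested on the spanning differences [x] - [e_X x]. *)
Lemma VXY_vanish (W : vectType k) (F : {ffun M -> k^o} -> W) : linear F ->
  (forall x, x \in eYL eX eY -> F (cls x) = F (cls (eX ** x))) ->
  forall v, v \in VXY -> F v = 0.
Proof.
move=> linF F0 v vV; apply/eqP; rewrite -(linfun_apply linF) -memv_ker.
apply: subvP vV; apply/span_subvP => _ /mapP[x xL ->].
rewrite memv_ker linearB /= !(linfun_apply linF) F0 ?subrr //.
by move: xL; rewrite mem_enum inE => /andP[].
Qed.

Lemma VXY_supp v z : v \in VXY -> z \notin eYL eX eY -> v z = 0.
Proof.
move=> vV zL; apply: (VXY_vanish (F := fun v : {ffun M -> k^o} => v z)) vV => [c u w|x _].
  by rewrite !ffunE.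
by rewrite !ffunE (negbTE zL).
Qed.

Lemma VXY_equiv v x y : v \in VXY -> equivXY eX eY x y -> v x = v y.
Proof.
move=> vV xy; apply/eqP; rewrite -subr_eq0; apply/eqP.
apply: (VXY_vanish (F := fun v : {ffun M -> k^o} => v x - v y)) vV => [c u w|z _].
  by rewrite !ffunE opprD addrACA scalerBr.
have cls_xy u : cls u x = cls u y.
  rewrite !ffunE (equiv_eYL orthoM idY xy) !equivE.
  by rewrite (same_connect_r (@gen_sym_connect _ _ _) xy).
by rewrite !cls_xy !subrr.
Qed.

(** The elements x and e_X x lie in the same fibre of x to e_X x, so their classes contribute
    equally to the sum. *)
Lemma VXY_sum v : v \in VXY -> \sum_(o : O | eX ** val o == eX) v (val o) = 0.
Proof.
move=> vV.
apply: (VXY_vanish (F := fun v : {ffun M -> k^o} => \sum_(o : O | eX ** val o == eX) v (val o))) vV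
  => [c u w|x xL].
  by rewrite scaler_sumr -big_split; apply: eq_bigr => o _; rewrite !ffunE.
have sum_cls u : u \in eYL eX eY ->
    \sum_(o : O | eX ** val o == eX) cls u (val o) = (eX ** u == eX)%:R.
  move=> uL; have clu := equiv_mulX orthoM idX idY ltXY (equiv_cl orthoM idX idY ltXY uL).
  rewrite big_mkcond (bigD1 (cl u)) //= big1 => [|o /negbTE ou].
    by rewrite addr0 -clu cls_cl // eqxx; case: eqP.
  by rewrite cls_cl // [cl u == o]eq_sym ou; case: ifP.
have XxL : eX ** x \in eYL eX eY.
  exact: (maxsubX_eYL orthoM idX idY ltXY (eYL_eX orthoM idX idY ltXY xL)).
by rewrite !sum_cls // mmulA (idemE idX).
Qed.

Variables (nU nV : nat) (rU : M -> 'M[k]_nU) (rV : M -> 'M[k]_nV).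
Hypotheses (grepU : is_grep eX rU) (grepV : is_grep eY rV).
Local Notation S' := (rep_dual eX (Defs.lift eX rU)).
Local Notation T' := (rep_dual eY (Defs.lift eY rV)).
Local Notation W := (tens_dual eX rV rU).
Let repS' : rep_at eX S' := rep_dual_rep_at orthoM idX (lift_rep_at orthoM idX grepU).
Let repT' : rep_at eY T' := rep_dual_rep_at orthoM idY (lift_rep_at orthoM idY grepV).

Lemma rep_dual_lift e n (rho : M -> 'M[k]_n) g : idem e -> is_grep e rho ->
  g \in maxsub e -> rep_dual e (Defs.lift e rho) g = (rho (ginv e g))^T.
Proof.
move=> ide grep gG; have [_ _ eg] := maxsubP orthoM _ ide gG.
have [g'G _ _] := ginvP orthoM ide gG.
rewrite /rep_dual eg -(lift_maxsub orthoM rho ide g'G).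
by rewrite (rep_at_ginv orthoM ide (lift_rep_at orthoM ide grep)).
Qed.

Lemma tens_dual_act (A : 'M[k]_nV) (B : 'M[k]_nU) (F : 'M[k]_(nV, nU)) i l :
  (A^T *m F *m B^T) i l =
  \sum_(s : 'I_(nV * nU)) tensmx A B^T s (mxtens_index (i, l)) *
     F (mxtens_unindex s).1 (mxtens_unindex s).2.
Proof.
rewrite (reindex (@mxtens_index nV nU)); last first.
  exact: onW_bij (Bijective (@mxtens_indexK _ _) (@mxtens_unindexK _ _)).
rewrite (eq_bigr (fun p => A p.1 i * B l p.2 * F p.1 p.2)) => [|[s t] _]; last first.
  by rewrite tensmxE mxtens_indexK mxE.
rewrite -(pair_bigA _ (fun s t => A s i * B l t * F s t)) exchange_big mxE /=.
apply: eq_bigr => t _; rewrite mxE mulr_suml; apply: eq_bigr => s _.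
by rewrite !mxE mulrAC.
Qed.

(** Entry (i, l) at a class is the coefficient of that class in the image of the basis vector (i, l)
    of the tensor product; this turns a homomorphism into a matrix-valued map on classes. *)
Definition hom_coords (phi : {ffun 'I_(nV * nU) -> subvs_of VXY}) : {ffun O -> 'M[k]_(nV, nU)} :=
  [ffun o => \matrix_(i, l) (vsval (phi (mxtens_index (i, l))) (val o) : k)].

Lemma hom_coords_linear : linear hom_coords.
Proof.
move=> c u v; apply/ffunP => o; apply/matrixP => i l.
by rewrite !ffunE !mxE !ffunE.
Qed.

Lemma hom_coords_inj phi : hom_coords phi = 0 -> phi = 0.
Proof.
move=> /ffunP phi0; apply/ffunP => j; rewrite [RHS]ffunE; apply: val_inj.
rewrite linear0; apply/ffunP => z; rewrite [RHS]ffunE.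
have [zL|zL] := boolP (z \in eYL eX eY); last exact: VXY_supp (subvsP _) zL.
rewrite (VXY_equiv (subvsP _) (equiv_cl orthoM idX idY ltXY zL)).
case: (mxtens_indexP j) => i l.
by have /matrixP/(_ i l) := phi0 (cl z); rewrite !ffunE !mxE.
Qed.

Lemma hom_map_linear d (rW : M * M -> 'M[k]_d) : linear (@hom_map k M eX eY d rW).
Proof.
move=> c u v; apply/ffunP => p; rewrite !ffunE; apply/ffunP => j; rewrite !ffunE.
case: ifP => _; last by rewrite scaler0 addr0.
rewrite scalerBr addrACA -opprD; congr (_ - _).
  by apply/ffunP => z; rewrite !ffunE; case: ifP => _; rewrite ?scaler0 ?addr0 ?ffunE.
rewrite scaler_sumr -big_split; apply: eq_bigr => i _.
by rewrite !ffunE scalerDr !scalerA mulrC.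
Qed.

Lemma hom_mapP d (rW : M * M -> 'M[k]_d) (phi : {ffun 'I_d -> subvs_of VXY}) :
  reflect (forall g h z, g \in maxsub eY -> h \in maxsub eX -> z \in eYL eX eY -> forall j,
     vsval (phi j) (ginv eY g ** z ** h) = \sum_i rW (g, h) i j * vsval (phi i) z)
   (phi \in lker (linfun (hom_map rW))).
Proof.
rewrite memv_ker (linfun_apply (@hom_map_linear _ rW)).
apply: (iffP eqP) => [/ffunP hom g h z gG hG zL j|hom].
  have := hom (g, h); rewrite !ffunE /in_GYX /= gG hG /= => /ffunP/(_ j).
  rewrite !ffunE => /ffunP/(_ z)/eqP; rewrite !ffunE zL subr_eq0 sum_ffunE => /eqP ->.
  by apply: eq_bigr => i _; rewrite ffunE.
apply/ffunP => -[g h]; apply/ffunP => j; rewrite !ffunE /in_GYX /=.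
case: ifP => // /andP[gG hG]; apply/ffunP => z; rewrite !ffunE sum_ffunE.
have [zL|zL] := boolP (z \in eYL eX eY).
  rewrite hom //; apply/eqP; rewrite subr_eq0; apply/eqP; apply: eq_bigr => i _.
  by rewrite ffunE.
rewrite big1 ?subrr // => i _.
by rewrite ffunE (VXY_supp (subvsP _) zL) scaler0.
Qed.

Definition fibre_sum (f : {ffun O -> 'M[k]_(nV, nU)}) : {ffun unit -> 'M[k]_(nV, nU)} :=
  [ffun=> \sum_(o | eX ** val o == eX) f o].

Lemma fibre_sum_linear : linear fibre_sum.
Proof.
move=> c u v; apply/ffunP => -[]; rewrite !ffunE scaler_sumr -big_split.
by apply: eq_bigr => o _; rewrite !ffunE.
Qed.

Lemma hom_coords_ker phi : phi \in lker (linfun (hom_map W)) ->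
  (hom_coords phi \in class_maps orthoM idX idY ltXY S' T') /\ fibre_sum (hom_coords phi) = 0.
Proof.
move=> /hom_mapP hom; split.
  apply/class_mapsP => g h x gG hG xL; apply/matrixP => i l.
  have [g'G _ _] := ginvP orthoM idY gG; have ghL := eYL_act orthoM idX idY ltXY gG xL hG.
  rewrite !rep_dual_lift // tens_dual_act ffunE mxE.
  rewrite -(VXY_equiv (subvsP _) (equiv_cl orthoM idX idY ltXY ghL)).
  have := hom (ginv eY g) h x g'G hG xL (mxtens_index (i, l)).
  rewrite (ginvK orthoM idY gG) => ->; apply: eq_bigr => s _; congr (_ * _).
  case: (mxtens_indexP s) => s0 s1; rewrite mxtens_indexK ffunE mxE.
  exact: VXY_equiv (subvsP _) (equiv_cl orthoM idX idY ltXY xL).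
apply/ffunP => -[]; rewrite !ffunE; apply/matrixP => i l; rewrite summxE mxE.
rewrite -[RHS](VXY_sum (subvsP (phi (mxtens_index (i, l))))).
by apply: eq_bigr => o _; rewrite ffunE mxE.
Qed.

Lemma cl_mulX x : x \in eYL eX eY -> eX ** val (cl x) = eX ** x.
Proof. by move=> xL; rewrite -(equiv_mulX orthoM idX idY ltXY (equiv_cl _ _ _ _ xL)). Qed.

(** Right translation by h carries the fibre over e_X onto the fibre over h. *)
Lemma fibre_sum_translate f h : f \in class_maps orthoM idX idY ltXY S' T' ->
  h \in maxsub eX -> \sum_(o | eX ** val o == h) f o = fibre_sum f tt *m S' h.
Proof.
move=> /class_mapsP eqv hG; pose h' : GX := exist _ h hG.
have [Xh _ _] := maxsubP orthoM _ idX hG.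
rewrite (reindex_inj (@cl_act_inj _ orthoM _ _ idX idY ltXY (1%g, h'^-1%g))) /=.
rewrite ffunE mulmx_suml; apply: eq_big => [o|o _].
  have oL := val_eYL o; have [Yo _ _] := eYLP orthoM idX idY ltXY _ oL.
  rewrite /cl_act; cbn [fst snd]; rewrite invgK /= Yo cl_mulX; last first.
    by rewrite -Yo eYL_act // maxsub_id.
  have [_ mXo _] := maxsubP orthoM _ idX (eYL_eX orthoM idX idY ltXY oL).
  rewrite mmulA; apply/eqP/eqP => [oh|->]; last exact: Xh.
  have := units_mulmV h' => /= hh'.
  have : eX ** val o ** h ** ginv eX h = eX by rewrite oh hh'.
  by rewrite -mmulA hh' mXo.
have oL := val_eYL o.
rewrite /cl_act; cbn [fst snd]; rewrite invgK /= eqv ?maxsub_id //.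
by rewrite (rep_at_id repT') mul1mx valK_cl.
Qed.

Lemma hom_coords_surj f : f \in class_maps orthoM idX idY ltXY S' T' -> fibre_sum f = 0 ->
  exists2 phi, phi \in lker (linfun (hom_map W)) & f = hom_coords phi.
Proof.
move=> fE f0.
pose u (s : 'I_(nV * nU)) : {ffun M -> k^o} :=
  \sum_(o : O) (f o (mxtens_unindex s).1 (mxtens_unindex s).2 : k) *: cls (val o).
have uV s : u s \in VXY.
  have XL (o : O) : eX ** val o \in maxsub eX := eYL_eX orthoM idX idY ltXY (val_eYL o).
  (* The subtracted terms cancel: grouped by the value h of e_X o, their coefficients are the fibre
     sums over h, all zero by translation. *)
  have -> : u s = \sum_(o : O) (f o (mxtens_unindex s).1 (mxtens_unindex s).2 : k) *:
      (cls (val o) - cls (eX ** val o)).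
    under [RHS]eq_bigr => o _ do rewrite scalerBr.
    rewrite sumrB [X in _ - X](partition_big (fun o : O => eX ** val o) (mem (maxsub eX))) /=; last first.
      by move=> o _; apply: XL.
    rewrite [X in _ - X]big1 ?subr0 // => h hG.
    rewrite (eq_bigr (fun o : O => (f o (mxtens_unindex s).1 (mxtens_unindex s).2 : k) *: cls h)); last first.
      by move=> o /eqP ->.
    rewrite -scaler_suml; have := fibre_sum_translate fE hG.
    rewrite f0 ffunE mul0mx => /matrixP/(_ (mxtens_unindex s).1 (mxtens_unindex s).2).
    by rewrite summxE mxE => ->; rewrite scale0r.
  apply: memv_suml => o _; apply: memvZ.
  have [oG|oG] := boolP (val o \in maxsub eX).
    have [-> _ _] := maxsubP orthoM _ idX oG.
    by rewrite subrr mem0v.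
  apply: memv_span; apply/mapP; exists (val o) => //.
  by rewrite mem_enum inE oG val_eYL.
pose phi : {ffun 'I_(nV * nU) -> subvs_of VXY} := [ffun s => Subvs (uV s)].
have phiE s z : z \in eYL eX eY ->
    vsval (phi s) z = f (cl z) (mxtens_unindex s).1 (mxtens_unindex s).2.
  move=> zL; rewrite (VXY_equiv (subvsP _) (equiv_cl orthoM idX idY ltXY zL)).
  rewrite ffunE /= /u sum_ffunE (bigD1 (cl z)) //= big1 => [|o /negbTE oz].
    by rewrite addr0 ffunE cls_cl ?val_eYL // valK_cl eqxx [LHS]mulr1.
  by rewrite ffunE cls_cl ?val_eYL // valK_cl oz scaler0.
exists phi; last first.
  apply/ffunP => o; apply/matrixP => i l; rewrite ffunE mxE phiE ?val_eYL //.
  by rewrite mxtens_indexK valK_cl.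
apply/hom_mapP => g h z gG hG zL j.
have [g'G _ _] := ginvP orthoM idY gG.
rewrite phiE ?eYL_act // (class_mapsP _ _ _ _ _ _ _ fE) //.
rewrite !rep_dual_lift // (ginvK orthoM idY gG).
case: (mxtens_indexP j) => i l; rewrite mxtens_indexK tens_dual_act.
by apply: eq_bigr => s _; rewrite phiE.
Qed.

Hypothesis cardY : #|maxsub eY|%:R != 0 :> k.

Lemma mulX_mul g x : g \in maxsub eY -> x \in eYL eX eY ->
  eX ** (g ** x) = eX ** g ** eX ** (eX ** x).
Proof.
move=> gG xL; rewrite !mmulA mulK_idem //.
exact: (mulX_eYL orthoM idX idY ltXY (maxsubY_jge orthoM idY ltXY gG) xL).
Qed.

(** With h = e_X g e_X, left translation by g and right translation by h both carry the fibre over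
    e_X onto the fibre over h, and S'(g) = S'(h). *)
Lemma fibre_sum_intertwiner f : f \in class_maps orthoM idX idY ltXY S' T' ->
  fibre_sum f \in intertwiners orthoM idY S' T'.
Proof.
move=> fE; apply/(intertwinersP orthoM idX idY ltXY T' repS') => g gG.
have hG := maxsub_corner orthoM idX (maxsubY_jge orthoM idY ltXY gG).
have [Xh hX _] := maxsubP orthoM _ idX hG.
have -> : S' g = S' (eX ** g ** eX).
  by rewrite !(rep_atM repS') (rep_at_id repS') mul1mx mulmx1.
rewrite -(fibre_sum_translate fE hG) ffunE mulmx_sumr; pose g' : GY := exist _ g gG.
rewrite [RHS](reindex_inj (@cl_act_inj _ orthoM _ _ idX idY ltXY (g', 1%g))) /=.
have actE (o : O) : act (g', 1%g) o = cl (g ** val o ** eX).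
  by rewrite /cl_act; cbn [fst snd]; rewrite invg1.
apply: eq_big => [o|o _]; last first.
  rewrite actE (class_mapsP _ _ _ _ _ _ _ fE) ?val_eYL ?maxsub_id //.
  by rewrite (rep_at_id repS') mulmx1 valK_cl.
have oL := val_eYL o; have [_ oX _] := eYLP orthoM idX idY ltXY _ oL.
have [XoX _ _] := maxsubP orthoM _ idX (eYL_eX orthoM idX idY ltXY oL).
rewrite actE cl_mulX; last by rewrite eYL_act ?maxsub_id.
rewrite -mmulA oX mulX_mul //; apply/eqP/eqP => [->|]; first by rewrite hX.
have [_ _ h'h] := ginvP orthoM idX hG; move/(congr1 (mmul (ginv eX (eX ** g ** eX)))).
by rewrite mmulA h'h XoX.
Qed.

Lemma fibre_sum_surj z : z \in intertwiners orthoM idY S' T' ->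
  exists2 f, f \in class_maps orthoM idX idY ltXY S' T' & fibre_sum f = z.
Proof.
move=> /(intertwinersP orthoM idX idY ltXY T' repS') inter.
have XL := eX_eYL orthoM idX idY ltXY.
pose L (p : GY * GX) := T' (val p.1); pose R (p : GY * GX) := S' (val (p.2^-1)%g).
(* Averaging z placed at the class of e_X: each pair (g, h) with e_X g h^-1 = e_X contributes z to
   the fibre sum. *)
pose f := eqv_avg act L R (cl eX) (z tt).
have fE : f \in class_maps orthoM idX idY ltXY S' T'.
  apply: eqv_avg_mem => [||p q|p q].
  - exact: cl_act_inj.
  - exact: cl_actM.
  - by rewrite /L -(rep_atM repT').
  - by rewrite /R -(rep_atM repS') -units_valM -invMg.
pose P (p : GY * GX) := eX ** val (act p (cl eX)) == eX.
have PE p : P p = (eX ** val p.1 ** val (p.2^-1)%g == eX).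
  have [_ _ _] := eYLP orthoM idX idY ltXY _ XL.
  have [Xh _ _] := maxsubP orthoM _ idX (valP (p.2^-1)%g).
  rewrite /P cl_act_cl // cl_mulX; last by rewrite eYL_act ?(valP p.1) ?(valP (p.2^-1)%g).
  by rewrite -(mmulA _ eX) Xh !mmulA.
have fz : fibre_sum f = #|P|%:R *: z.
  apply/ffunP => -[]; rewrite !ffunE.
  under eq_bigr => o _ do rewrite ffunE.
  transitivity (\sum_(p | P p) z tt).
    rewrite [RHS](partition_big (fun p => act p (cl eX)) (fun o : O => eX ** val o == eX)) //=.
    apply: eq_bigr => o oX; apply: eq_big => [p|p /eqP po].
      by rewrite /P; case: eqP => [->|]; rewrite ?oX ?andbF.
    have : P p by rewrite /P po.
    rewrite PE => /eqP pX; rewrite /L /R inter ?(valP p.1) // -mulmxA -(rep_atM repS').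
    rewrite -[S' _]mul1mx -(rep_at_id repS') -(rep_atM repS') mmulA pX.
    by rewrite (rep_at_id repS') mulmx1.
  by rewrite sumr_const scaler_nat.
have cardP : #|P| = #|maxsub eY|.
  have cG (g : GY) : eX ** val g ** eX \in maxsub eX.
    by apply: maxsub_corner => //; apply: (maxsubY_jge orthoM idY ltXY (valP g)).
  (* These pairs form the graph of g to e_X g e_X, so there are |G_Y| of them and dividing by this
     number gives a preimage of z. *)
  pose c (g : GY) : GY * GX := (g, exist _ (eX ** val g ** eX) (cG g)).
  rewrite -(card_units_at orthoM idY) -(@card_image _ _ c) => [|g g' [->] //].
  apply: eq_card => p; rewrite [LHS]PE; apply/eqP/imageP => [pX|[g _ ->]]; last first.
    have /= := units_mulmV (c g).2.
    have [g'G _ _] := ginvP orthoM idX (cG g); have [Xg' _ _] := maxsubP orthoM _ idX g'G.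
    by rewrite -(mmulA _ eX) Xg'.
  exists p.1 => //; apply/eqP; rewrite -pair_eqE /= /pair_eq /= eqxx /=; apply/eqP.
  apply: val_inj => /=; have [Xh _ _] := maxsubP orthoM _ idX (valP p.2).
  by have := congr1 (fun z => z ** val p.2) pX; rewrite -mmulA units_mulVm Xh => ->.
exists (#|maxsub eY|%:R^-1 *: f); first by rewrite memvZ.
have := fibre_sum_linear #|maxsub eY|%:R^-1 f 0; rewrite addr0 fz cardP => ->.
rewrite scalerA mulVf // scale1r.
have -> : fibre_sum 0 = 0.
  by apply/ffunP => -[]; rewrite !ffunE big1 // => o _; rewrite ffunE.
by rewrite addr0.
Qed.

(** Rank-nullity for [fibre_sum], which is onto the intertwiners and whose kernel is the image of
    the injective [hom_coords]. *)
Lemma dimHom_tens_dual : dimHomXY eX eY W =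
  (\dim (class_maps orthoM idX idY ltXY S' T') - \dim (intertwiners orthoM idY S' T'))%N.
Proof.
set E1 := class_maps _ _ _ _ _ _; set E2 := intertwiners _ _ _ _.
have sumE := linfun_apply fibre_sum_linear; have homE := linfun_apply hom_coords_linear.
have <- : (linfun fibre_sum @: E1)%VS = E2.
  apply/eqP; rewrite eqEsubv; apply/andP; split; apply/subvP => z.
    by case/memv_imgP=> f fE ->; rewrite sumE; apply: fibre_sum_intertwiner.
  by case/fibre_sum_surj=> f fE <-; rewrite -sumE memv_img.
rewrite -(limg_ker_dim (linfun fibre_sum) E1) addnK /dimHomXY.
rewrite -(@limg_dim_eq _ _ _ (linfun hom_coords)); last first.
  apply/eqP; rewrite -subv0; apply/subvP => phi.
  rewrite memv_cap memv0 => /andP[_].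
  by rewrite memv_ker homE => /eqP/hom_coords_inj ->.
congr (\dim _); apply/eqP; rewrite eqEsubv; apply/andP; split; apply/subvP => f.
  case/memv_imgP=> phi /hom_coords_ker[fE f0] ->; rewrite homE memv_cap fE memv_ker.
  by rewrite sumE f0 eqxx.
rewrite memv_cap memv_ker sumE => /andP[fE /eqP f0].
by have [phi phiE ->] := hom_coords_surj fE f0; rewrite -homE memv_img.
Qed.

End HomDimension.

(** * The three cases assembled *)

Theorem mainTheorem3 (M : fmonoid) (k : fieldType)
  (orthoM : orthogroup M) (splitk : splits k M)
  (chark : forall e : M, idem e -> [pchar k]^'.-nat #|maxsub e|)
  (eX eY : M) (idX : idem eX) (idY : idem eY)
  (nU : nat) (rU : M -> 'M[k]_nU) (nV : nat) (rV : M -> 'M[k]_nV)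
  (repU : is_grep eX rU) (irrU : irr_on (maxsub eX) rU)
  (repV : is_grep eY rV) (irrV : irr_on (maxsub eY) rV) :
  (* (1) *)
  ((tideal eX = tideal eY \/
    (~~ (tideal eX \subset tideal eY) /\ ~~ (tideal eY \subset tideal eX))) ->
     arrows eX rU eY rV = 0%N)
  /\
  (* (2) *)
  (tideal eX \proper tideal eY -> idem_lt eX eY ->
     arrows eX rU eY rV = multXY eX eY (tens_dual eX rV rU))
  /\
  (* (3) *)
  (tideal eY \proper tideal eX ->
     arrows eX rU eY rV =
     @arrows k (opmon M) eY _ (oprep eY rV) eX _ (oprep eX rU)).
Proof.
have cardG (e : M) : idem e -> #|maxsub e|%:R != 0 :> k.
  by move=> ide; rewrite natf_neq0_pchar chark.
have repS := lift_rep_at orthoM idX repU; have repT := lift_rep_at orthoM idY repV.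
split; [|split].
- case=> [XY|[]]; first exact: (dimExt1_same orthoM idX idY repS repT XY (cardG _ idX)).
  by rewrite !tideal_sub; apply: (dimExt1_incomparable orthoM repS repT).
- move=> _ ltXY; rewrite /multXY (dimHom_tens_dual orthoM idX idY ltXY repU repV (cardG _ idY)).
  (* The endomorphism space has dimension 1, so the multiplicity is the dimension of the Hom space;
     it remains to pass from U, V to their contragredients. *)
  rewrite dimEnd_tens_dual ?divn1 //; [|exact: splits_abs_irr|exact: splits_abs_irr].
  rewrite /arrows (dimExt1_classes orthoM idX idY ltXY repS repT (cardG _ idY)).
  have repS' := rep_dual_rep_at orthoM idX repS; have repT' := rep_dual_rep_at orthoM idY repT.
  have dualS := rep_dual_contragredient orthoM idX repS.
  have dualT := rep_dual_contragredient orthoM idY repT.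
  rewrite (dim_class_maps_dual orthoM idX idY ltXY (cardG _ idX) (cardG _ idY)
    repS repT repS' repT' dualS dualT).
  by rewrite (dim_intertwiners_dual orthoM idY ltXY (cardG _ idY)
    repS repT repS' repT' dualS dualT).
- exact: arrows_op.
Qed.
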